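(* For $z\in\mathbb C\setminus[1,\infty)$, $$g(z)=\int_0^1\frac{\rho(s)}{1-sz}\,\mathrm ds,$$ where $$\rho(s)=\frac{2L(1-s^2)}{\left(2Ls+(1-s)\log\frac{1-s}{s}\right)^2+\pi^2(1-s)^2},\qquad 0<s<1.$$ In particular, with $f=-g$, $$f(z)=-\sum_{m=0}^\infty b_mz^m\quad(|z|<1),\qquad b_m=\int_0^1s^m\rho(s)\,\mathrm ds>0.$$ More strongly, for all integers $k,m\ge0$, $$\sum_{j=0}^k(-1)^j\binom kj b_{m+j}=\int_0^1s^m(1-s)^k\rho(s)\,\mathrm ds>0.$$
   Context: Put $L=\log2$. On $\mathbb C\setminus[1,\infty)$, with the principal branch of $\log(1-z)$, $$g(z)=\frac{2Lz+(1-z)\log(1-z)}{z\bigl(2L-(1-z)\log(1-z)\bigr)},$$ where the apparent singularities at $z=0$ and $z=-1$ are removable, with $g(0)=\frac{2L-1}{2L}$ and $g(-1)=\frac{1-L}{1+L}$. (On the unit disk, $f=-g$ is the Schur function of the circle probability measure that is the distribution of $e^{2i\arccos X}$, where $X$ has density $\frac1{\pi L}\frac{\arcsin x}x$ on $(-1,1)$.) *)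

(* Defs.v *)
From Stdlib Require Import Reals Lra.
From Coquelicot Require Import Coquelicot.
Open Scope R_scope.

(* [acos] takes values in [0, PI], so for w <> 0 this is the argument of w
   in (-PI, PI]; see [Clog_principal]. *)
Definition Carg (w : C) : R :=
  if Rle_dec 0 (Im w) then acos (Re w / Cmod w) else - acos (Re w / Cmod w).

Definition Clog (w : C) : C := (ln (Cmod w), Carg w).

Lemma Clog_principal (w : C) : w <> RtoC 0 ->
  exp (Re (Clog w)) * cos (Im (Clog w)) = Re w /\
  exp (Re (Clog w)) * sin (Im (Clog w)) = Im w /\
  - PI < Im (Clog w) <= PI.
Proof.
intros hw.
assert (hm : 0 < Cmod w) by now apply Cmod_gt_0.
assert (hs : Cmod w * Cmod w = Re w * Re w + Im w * Im w).
{ unfold Cmod; rewrite sqrt_sqrt; [unfold Re, Im; ring | nra]. }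
set (u := Re w / Cmod w).
assert (eu : u * Cmod w = Re w) by (unfold u; field; lra).
assert (hu : -1 <= u <= 1) 
  by (generalize (re_le_Cmod w); intros H; apply Rabs_le_between in H;
      split; apply (Rmult_le_reg_r (Cmod w)); lra).
assert (es : Cmod w * sqrt (1 - u²) = Rabs (Im w)).
{ rewrite <- (sqrt_Rsqr (Cmod w)) at 1 by lra.
  rewrite <- sqrt_mult, <- sqrt_Rsqr_abs; unfold Rsqr in *; [|nra|nra].
  f_equal; replace (Im w * Im w) with (Cmod w * Cmod w - Re w * Re w) by lra.
  rewrite <- eu; ring. }
destruct (acos_bound u) as [h0 h1].
simpl; rewrite exp_ln by exact hm; unfold Carg; fold u.
destruct (Rle_dec 0 (Im w)) as [hI|hI].
- rewrite cos_acos, sin_acos, es, Rabs_pos_eq by assumption.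
  generalize PI_RGT_0; lra.
- rewrite cos_neg, sin_neg, cos_acos, sin_acos by assumption.
  rewrite Ropp_mult_distr_r_reverse, es, Rabs_left by lra.
  enough (acos u <> PI) by lra.
  intros e; apply (f_equal cos) in e.
  rewrite cos_acos, cos_PI in e by assumption; nra.
Qed.

Definition ln2 : R := ln 2.

(* The formula is 0/0 at z = 0 and z = -1; both singularities are removable and
   the first two branches are the limits there. *)
Definition schur_g (z : C) : C :=
  if Ceq_dec z 0 then RtoC ((2 * ln2 - 1) / (2 * ln2))
  else if Ceq_dec z (-1) then RtoC ((1 - ln2) / (1 + ln2))
  else ((2 * ln2 * z + (1 - z) * Clog (1 - z))
        / (z * (2 * ln2 - (1 - z) * Clog (1 - z))))%C.

Definition schur_f (z : C) : C := (- schur_g z)%C.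

(* Only meaningful for 0 < s < 1.  The values at 0 and 1 are irrelevant to the
   Riemann integrals over [0, 1]: rho tends to 0 at both endpoints, so it is
   bounded and no improper integral is needed. *)
Definition rho (s : R) : R :=
  2 * ln2 * (1 - s ^ 2)
  / ((2 * ln2 * s + (1 - s) * ln ((1 - s) / s)) ^ 2 + PI ^ 2 * (1 - s) ^ 2).

Definition moment_b (m : nat) : R := RInt (fun s => s ^ m * rho s) 0 1.

(* Main.v *)
Require Import Defs.
From Stdlib Require Import Reals Lra Psatz.
From Coquelicot Require Import Coquelicot.
Open Scope R_scope.

(* Put w = 1 - z0, L = log 2, G(w) = (2 - w) / (2L - w log w).  The function g is
   -2L times the divided difference of G at w0 = 1 - z0 and 1, and
   2 L u (u + 2) / |2L - w log w|^2 at w = -u (u = (1 - s) / s) is both rho(s) and,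
   up to a factor, the jump of G across its cut.  In the coordinate
   zeta = log w the cut plane becomes the strip |Im zeta| < pi.  The function
   w G[w, w0, 1] (second divided difference) extends continuously to the closed
   strip, since the zero of 2L - w log w at w = 2 is cancelled and there is no other
   one.  Cauchy's theorem on the rectangle |Re zeta| <= X, |Im zeta| <= pi then
   equates the integral of the jump along the cut with the contribution of the
   vertical sides, where w G[w, w0, 1] tends to 0 (left) and to -G[w0, 1] (right).
   The removable points z0 = 0, -1 follow by continuity in z0, the power series by
   expanding 1 / (1 - s z), and the last identity from the binomial theorem. *)

(** * Green's theorem on a rectangle *)

(** With s = 1/(1+u), the form ds/(1 - s z0) becomes, up to sign, u dx/((u + w0)(u + 1)) with u =
    exp x. At w = -u the denominator is (w - w0)(w - 1), which is why the nodes are w0 and 1; the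
    factor w comes from dw = w d zeta. Integrating G/((w - w0)(w - 1)) directly would need residues
    at both nodes. The divided difference subtracts terms that take equal values on the two edges of
    the cut, so the jump is unchanged and the poles disappear. Their contribution comes back as the
    limit on the right-hand side. The price is that [Gdd] has removable points at zeta = 0, log 2
    and log w0, where only continuity is proved. All three lie on the lines Im zeta = 0 and Im zeta
    = Im log w0. Cutting the rectangle along these lines leaves strips on which the integrand is C^1
    holomorphic inside and continuous up to the boundary, and this is the form of Green's theorem
    proved first. *)

Lemma locally_interval (c d y : R) :
  c < y < d -> locally y (fun v => c < v < d).
Proof.
intros hy.
assert (hm : 0 < Rmin (y - c) (d - y)) by (apply Rmin_glb_lt; lra).
exists (mkposreal _ hm); intros v hv.
apply Rabs_lt_between' in hv; simpl in hv.
generalize (Rmin_l (y - c) (d - y)) (Rmin_r (y - c) (d - y)); lra.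
Qed.

Lemma continuity_2d_pt_swap (f : R -> R -> R) (x y : R) :
  continuity_2d_pt f x y -> continuity_2d_pt (fun u v => f v u) y x.
Proof.
intros H eps; destruct (H eps) as [d Hd].
exists d; intros u v hu hv; now apply Hd.
Qed.

Lemma continuity_2d_pt_continuous_l (f : R -> R -> R) (x y : R) :
  continuity_2d_pt f x y -> continuous (fun u => f u y) x.
Proof.
intros H; apply continuity_pt_filterlim, continuity_pt_locally; intros eps.
destruct (H eps) as [d Hd].
exists d; intros u hu; apply Hd; [exact hu|].
rewrite Rminus_diag, Rabs_R0; apply cond_pos.
Qed.

Lemma continuity_2d_pt_continuous_r (f : R -> R -> R) (x y : R) :
  continuity_2d_pt f x y -> continuous (fun v => f x v) y.
Proof.
intros H; apply (continuity_2d_pt_continuous_l (fun u v => f v u)).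
now apply continuity_2d_pt_swap.
Qed.

Lemma continuous_RInt_param (f : R -> R -> R) (a b y : R) :
  a <= b ->
  (forall x v, a <= x <= b -> continuity_2d_pt f x v) ->
  continuity_pt (fun v => RInt (fun x => f x v) a b) y.
Proof.
intros hab Hf.
assert (ex : forall v, ex_RInt (fun x => f x v) a b).
{ intros v; apply (ex_RInt_continuous (V := R_CompleteNormedModule)).
  rewrite Rmin_left, Rmax_right by exact hab.
  intros x hx; now apply (continuity_2d_pt_continuous_l f), Hf. }
apply continuity_pt_locally; intros eps.
(* The added 1 keeps the divisor positive when a = b. *)
assert (he : 0 < eps / (b - a + 1)) 
  by (apply Rdiv_lt_0_compat; [apply cond_pos | lra]).
destruct (uniform_continuity_2d_1d f a b y (fun x hx => Hf x y hx)
            (mkposreal _ he)) as [d Hd]; simpl in Hd.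
exists d; intros v hv.
assert (hv' : y - d <= v <= y + d).
{ apply Rabs_lt_between' in hv; lra. }
rewrite <- (RInt_minus (V := R_CompleteNormedModule)) by apply ex.
apply Rle_lt_trans with ((b - a) * (eps / (b - a + 1))).
- apply abs_RInt_le_const; [exact hab | |].
  + now apply (ex_RInt_minus (V := R_NormedModule)).
  + intros x hx; apply Rlt_le, (Hd x y x v hx); [|exact hx|exact hv'|].
    * generalize (cond_pos d); lra.
    * rewrite Rminus_diag, Rabs_R0; apply cond_pos.
- generalize (cond_pos eps); intros.
  apply Rmult_lt_reg_r with (b - a + 1); [lra|].
  replace ((b - a) * (eps / (b - a + 1)) * (b - a + 1)) with ((b - a) * eps)
    by (field; lra).
  nra.
Qed.

(* Under the integral sign, [d/dy int f dx = int d_x g dx = g b y - g a y]. *)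
Lemma Green_rectangle_aux (f g k : R -> R -> R) (a b c d : R) :
  a <= b -> c <= d ->
  (forall x y, a <= x <= b -> continuity_2d_pt f x y) ->
  (forall x y, a <= x <= b -> continuity_2d_pt g x y) ->
  (forall x y, c < y < d ->
     is_derive (fun v => f x v) y (k x y) /\
     is_derive (fun u => g u y) x (k x y) /\ continuity_2d_pt k x y) ->
  RInt (fun x => f x d) a b - RInt (fun x => f x c) a b =
  RInt (fun y => g b y - g a y) c d.
Proof.
intros hab hcd Hf Hg Hk.
set (h := fun y => g b y - g a y).
assert (hh : forall y, continuous h y).
{ intros y; apply (continuous_minus (V := R_NormedModule) (g b) (g a));
    apply continuity_2d_pt_continuous_r, Hg; lra. }
assert (exh : forall u v, ex_RInt h u v)
  by (intros; apply (ex_RInt_continuous (V := R_CompleteNormedModule)); auto).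
(* [Phi] is continuous up to the ends and has derivative 0 inside, so the mean value theorem needs
   [k] only on the open interval. *)
set (Phi := fun y => RInt (fun x => f x y) a b - RInt h c y).
assert (dh : forall y, is_derive (fun y => RInt h c y) y (h y)).
{ intros y; apply (is_derive_RInt (V := R_NormedModule)) with (a := c);
    [|apply hh].
  apply filter_forall; intros z; apply (RInt_correct (V := R_CompleteNormedModule)), exh. }
enough (e : Phi d = Phi c).
{ unfold Phi in e; rewrite RInt_point in e; unfold zero in e; simpl in e; lra. }
destruct (MVT_gen Phi c d (fun _ => 0)) as [y [_ e]]; [| |lra].
- rewrite Rmin_left, Rmax_right by exact hcd; intros y hy.
  replace 0 with (h y - h y) by ring.
  apply (is_derive_minus (K := R_AbsRing) (V := R_NormedModule)); [|apply dh].
  assert (e : h y = RInt (fun x => Derive (fun v => f x v) y) a b).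
  { symmetry; rewrite (RInt_ext _ (fun x => k x y)).
    - apply is_RInt_unique, (is_RInt_derive (fun u => g u y));
        rewrite Rmin_left, Rmax_right by exact hab; intros x hx;
        destruct (Hk x y hy) as (_ & h1 & h2); [exact h1|].
      now apply (continuity_2d_pt_continuous_l k).
    - rewrite Rmin_left, Rmax_right by exact hab; intros x hx.
      now apply is_derive_unique, Hk. }
  rewrite e.
  assert (loc := locally_interval c d y hy).
  apply (is_derive_RInt_param (fun y x => f x y)).
  + revert loc; apply filter_imp; intros v hv x.
    rewrite Rmin_left, Rmax_right by exact hab; intros hx.
    exists (k x v); now apply Hk.
  + rewrite Rmin_left, Rmax_right by exact hab; intros x hx.
    apply continuity_2d_pt_swap with (f := fun x y => Derive (fun v => f x v) y).
    apply continuity_2d_pt_ext_loc with k; [|now apply Hk].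
    destruct loc as [r Hr]; exists r; intros u v _ hv.
    symmetry; apply is_derive_unique, Hk, Hr, hv.
  + apply filter_forall; intros v.
    apply (ex_RInt_continuous (V := R_CompleteNormedModule)).
    rewrite Rmin_left, Rmax_right by exact hab.
    intros x hx; now apply (continuity_2d_pt_continuous_l f), Hf.
- rewrite Rmin_left, Rmax_right by exact hcd; intros y hy.
  apply continuity_pt_minus.
  + now apply continuous_RInt_param.
  + apply continuity_pt_filterlim, (ex_derive_continuous (V := R_NormedModule)).
    exists (h y); apply dh.
Qed.

(** Composing with this projection makes a function continuous at the points of the closed strip
    continuous at every point of the plane, as [Green_rectangle_aux] asks, without changing it on
    the strip. *)
Definition clamp (c d y : R) : R := Rmax c (Rmin d y).

Lemma clamp_id (c d y : R) : c <= y <= d -> clamp c d y = y.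
Proof. intros h; unfold clamp; rewrite Rmin_right, Rmax_right; lra. Qed.

Lemma clamp_bounds (c d y : R) : c <= d -> c <= clamp c d y <= d.
Proof.
intros h; unfold clamp; split; [apply Rmax_l|].
apply Rmax_lub; [exact h | apply Rmin_l].
Qed.

Lemma clamp_lipschitz (c d y v : R) :
  Rabs (clamp c d v - clamp c d y) <= Rabs (v - y).
Proof.
unfold clamp, Rmax, Rmin; repeat destruct Rle_dec; unfold Rabs;
  repeat destruct Rcase_abs; lra.
Qed.

Lemma continuity_2d_pt_clamp (f : R -> R -> R) (c d x y : R) :
  continuity_2d_pt f x (clamp c d y) ->
  continuity_2d_pt (fun u v => f u (clamp c d v)) x y.
Proof.
intros H eps; destruct (H eps) as [r Hr]; exists r; intros u v hu hv.
apply Hr; [exact hu|].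
now apply Rle_lt_trans with (2 := hv), clamp_lipschitz.
Qed.

Lemma Green_rectangle (f g k : R -> R -> R) (a b c d : R) :
  a <= b -> c <= d ->
  (forall x y, c <= y <= d -> continuity_2d_pt f x y) ->
  (forall x y, c <= y <= d -> continuity_2d_pt g x y) ->
  (forall x y, c < y < d ->
     is_derive (fun v => f x v) y (k x y) /\ is_derive (fun u => g u y) x (k x y) /\ continuity_2d_pt k x y) ->
  RInt (fun x => f x d) a b - RInt (fun x => f x c) a b =
  RInt (fun y => g b y - g a y) c d.
Proof.
intros hab hcd Hf Hg Hk.
set (cl := clamp c d).
transitivity (RInt (fun x => f x (cl d)) a b - RInt (fun x => f x (cl c)) a b).
{ unfold cl; rewrite !clamp_id by lra; reflexivity. }
rewrite (Green_rectangle_aux (fun x y => f x (cl y)) (fun x y => g x (cl y)) k);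
  [|exact hab|exact hcd| | |].
- apply RInt_ext; rewrite Rmin_left, Rmax_right by exact hcd; intros y hy.
  unfold cl; rewrite clamp_id by lra; reflexivity.
- intros x y _; apply continuity_2d_pt_clamp, Hf, clamp_bounds, hcd.
- intros x y _; apply continuity_2d_pt_clamp, Hg, clamp_bounds, hcd.
- intros x y hy; destruct (Hk x y hy) as (h1 & h2 & h3).
  split; [|split].
  + apply (is_derive_ext_loc (V := R_NormedModule) (fun v => f x v)); [|exact h1].
    generalize (locally_interval c d y hy); apply filter_imp; intros v hv.
    unfold cl; rewrite clamp_id by lra; reflexivity.
  + apply (is_derive_ext (V := R_NormedModule) (fun u => g u y)); [|exact h2].
    intros u.
    unfold cl; rewrite clamp_id by lra; reflexivity.
  + exact h3.
Qed.

(** * Holomorphic functions on horizontal strips *)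

Definition cont2 (f : C -> C) (z : C) : Prop :=
  continuity_2d_pt (fun x y => Re (f (x, y))) (Re z) (Im z) /\
  continuity_2d_pt (fun x y => Im (f (x, y))) (Re z) (Im z).

(* Complex derivative, expressed by the partial derivatives of [Re f] and
   [Im f] and the Cauchy-Riemann equations. *)
Definition is_hol (f : C -> C) (z l : C) : Prop :=
  (is_derive (fun x => Re (f (x, Im z))) (Re z) (Re l) /\
   is_derive (fun x => Im (f (x, Im z))) (Re z) (Im l)) /\
  (is_derive (fun y => Re (f (Re z, y))) (Im z) (- Im l) /\
   is_derive (fun y => Im (f (Re z, y))) (Im z) (Re l)).

(** Continuity of the derivative is included because the proof of Green's theorem differentiates
    under the integral sign. *)
Definition holo_strip (c d : R) (f : C -> C) : Prop :=
  exists f' : C -> C, forall z : C, c < Im z < d ->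
    cont2 f z /\ cont2 f' z /\ is_hol f z (f' z).

Lemma cont2_const (a z : C) : cont2 (fun _ => a) z.
Proof. split; apply continuity_2d_pt_const. Qed.

Lemma cont2_id (z : C) : cont2 (fun z => z) z.
Proof. split; [apply continuity_2d_pt_id1 | apply continuity_2d_pt_id2]. Qed.

Lemma cont2_opp (f : C -> C) (z : C) : cont2 f z -> cont2 (fun z => - f z)%C z.
Proof.
intros [h1 h2]; split.
- apply continuity_2d_pt_ext with (2 := continuity_2d_pt_opp _ _ _ h1); reflexivity.
- apply continuity_2d_pt_ext with (2 := continuity_2d_pt_opp _ _ _ h2); reflexivity.
Qed.

Lemma cont2_plus (f g : C -> C) (z : C) :
  cont2 f z -> cont2 g z -> cont2 (fun z => f z + g z)%C z.
Proof.
intros [h1 h2] [k1 k2]; split.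
- apply continuity_2d_pt_ext with (2 := continuity_2d_pt_plus _ _ _ _ h1 k1); reflexivity.
- apply continuity_2d_pt_ext with (2 := continuity_2d_pt_plus _ _ _ _ h2 k2); reflexivity.
Qed.

Lemma cont2_minus (f g : C -> C) (z : C) :
  cont2 f z -> cont2 g z -> cont2 (fun z => f z - g z)%C z.
Proof. intros hf hg; apply cont2_plus; [exact hf | now apply cont2_opp]. Qed.

Lemma cont2_mult (f g : C -> C) (z : C) :
  cont2 f z -> cont2 g z -> cont2 (fun z => f z * g z)%C z.
Proof.
intros [h1 h2] [k1 k2]; split.
- apply continuity_2d_pt_ext with (2 := continuity_2d_pt_minus _ _ _ _
    (continuity_2d_pt_mult _ _ _ _ h1 k1) (continuity_2d_pt_mult _ _ _ _ h2 k2));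
  reflexivity.
- apply continuity_2d_pt_ext with (2 := continuity_2d_pt_plus _ _ _ _
    (continuity_2d_pt_mult _ _ _ _ h1 k2) (continuity_2d_pt_mult _ _ _ _ h2 k1));
  reflexivity.
Qed.

Lemma Cneq_0_norm2 (z : C) : z <> 0 -> Re z ^ 2 + Im z ^ 2 <> 0.
Proof.
intros hz h; apply hz, injective_projections; unfold Re, Im in *; simpl in *; nra.
Qed.

Lemma cont2_inv (f : C -> C) (z : C) :
  cont2 f z -> f z <> 0 -> cont2 (fun z => / f z)%C z.
Proof.
intros [h1 h2] hz.
assert (hn : continuity_2d_pt
  (fun x y => / (Re (f (x, y)) * Re (f (x, y)) + Im (f (x, y)) * Im (f (x, y))))
  (Re z) (Im z)).
{ apply continuity_2d_pt_inv.
  - apply continuity_2d_pt_plus; now apply continuity_2d_pt_mult.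
  - apply Cneq_0_norm2 in hz; destruct z; simpl in *.
    unfold Re, Im in *; simpl in *; lra. }
split.
- apply continuity_2d_pt_ext with (2 := continuity_2d_pt_mult _ _ _ _ h1 hn).
  intros x y; unfold Cinv, Re, Im; simpl; unfold Rdiv; do 2 f_equal; ring.
- apply continuity_2d_pt_ext with (2 := continuity_2d_pt_mult _ _ _ _
    (continuity_2d_pt_opp _ _ _ h2) hn).
  intros x y; unfold Cinv, Re, Im; simpl; unfold Rdiv; do 2 f_equal; ring.
Qed.

Lemma cont2_div (f g : C -> C) (z : C) :
  cont2 f z -> cont2 g z -> g z <> 0 -> cont2 (fun z => f z / g z)%C z.
Proof. intros; apply cont2_mult; [|apply cont2_inv]; assumption. Qed.

Lemma is_derive_eq (f : R -> R) (x l l' : R) :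
  is_derive f x l -> l = l' -> is_derive f x l'.
Proof. now intros H <-. Qed.

Lemma is_derive_Rplus (f g : R -> R) (x l m : R) :
  is_derive f x l -> is_derive g x m -> is_derive (fun x => f x + g x) x (l + m).
Proof. exact (is_derive_plus (K := R_AbsRing) (V := R_NormedModule) f g x l m). Qed.

Lemma is_derive_Rminus (f g : R -> R) (x l m : R) :
  is_derive f x l -> is_derive g x m -> is_derive (fun x => f x - g x) x (l - m).
Proof. exact (is_derive_minus (K := R_AbsRing) (V := R_NormedModule) f g x l m). Qed.

Lemma is_derive_Ropp (f : R -> R) (x l : R) :
  is_derive f x l -> is_derive (fun x => - f x) x (- l).
Proof. exact (is_derive_opp (K := R_AbsRing) (V := R_NormedModule) f x l). Qed.

Lemma is_derive_Rmult (f g : R -> R) (x l m : R) :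
  is_derive f x l -> is_derive g x m ->
  is_derive (fun x => f x * g x) x (l * g x + f x * m).
Proof.
intros hf hg.
exact (is_derive_mult (K := R_AbsRing) f g x l m hf hg Rmult_comm).
Qed.

Lemma is_hol_opp (f : C -> C) (z l : C) :
  is_hol f z l -> is_hol (fun z => - f z)%C z (- l).
Proof.
intros [[h1 h2] [h3 h4]]; split; split; now apply is_derive_Ropp.
Qed.

Lemma is_hol_plus (f g : C -> C) (z l m : C) :
  is_hol f z l -> is_hol g z m -> is_hol (fun z => f z + g z)%C z (l + m).
Proof.
intros [[h1 h2] [h3 h4]] [[k1 k2] [k3 k4]]; split; split.
- exact (is_derive_Rplus _ _ _ _ _ h1 k1).
- exact (is_derive_Rplus _ _ _ _ _ h2 k2).
- apply is_derive_eq with (1 := is_derive_Rplus _ _ _ _ _ h3 k3); unfold Im; simpl; ring.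
- exact (is_derive_Rplus _ _ _ _ _ h4 k4).
Qed.

Lemma is_hol_mult (f g : C -> C) (z l m : C) :
  is_hol f z l -> is_hol g z m -> is_hol (fun z => f z * g z)%C z (l * g z + f z * m).
Proof.
destruct z as [x y]; intros [[h1 h2] [h3 h4]] [[k1 k2] [k3 k4]]; split; split.
- apply is_derive_eq with (1 := is_derive_Rminus _ _ _ _ _
    (is_derive_Rmult _ _ _ _ _ h1 k1) (is_derive_Rmult _ _ _ _ _ h2 k2)).
  unfold Re, Im; simpl; ring.
- apply is_derive_eq with (1 := is_derive_Rplus _ _ _ _ _
    (is_derive_Rmult _ _ _ _ _ h1 k2) (is_derive_Rmult _ _ _ _ _ h2 k1)).
  unfold Re, Im; simpl; ring.
- apply is_derive_eq with (1 := is_derive_Rminus _ _ _ _ _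
    (is_derive_Rmult _ _ _ _ _ h3 k3) (is_derive_Rmult _ _ _ _ _ h4 k4)).
  unfold Re, Im; simpl; ring.
- apply is_derive_eq with (1 := is_derive_Rplus _ _ _ _ _
    (is_derive_Rmult _ _ _ _ _ h3 k4) (is_derive_Rmult _ _ _ _ _ h4 k3)).
  unfold Re, Im; simpl; ring.
Qed.

(** The real and imaginary parts of 1/(p + iq) along a line; [is_hol_inv] uses it once horizontally
    and once vertically. *)
Lemma is_derive_re_im_inv (p q : R -> R) (x dp dq : R) :
  is_derive p x dp -> is_derive q x dq -> p x ^ 2 + q x ^ 2 <> 0 ->
  is_derive (fun x => p x / (p x ^ 2 + q x ^ 2)) x
    ((dp * (q x ^ 2 - p x ^ 2) - 2 * p x * q x * dq) / (p x ^ 2 + q x ^ 2) ^ 2) /\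
  is_derive (fun x => - q x / (p x ^ 2 + q x ^ 2)) x
    (- (dq * (p x ^ 2 - q x ^ 2) - 2 * p x * q x * dp) / (p x ^ 2 + q x ^ 2) ^ 2).
Proof.
intros hp hq hn.
assert (hd : is_derive (fun x => p x ^ 2 + q x ^ 2) x (2 * p x * dp + 2 * q x * dq)).
{ apply is_derive_eq with (2 * dp * p x ^ 1 + 2 * dq * q x ^ 1); [|ring].
  apply is_derive_Rplus; [exact (is_derive_pow p 2 x dp hp) | exact (is_derive_pow q 2 x dq hq)]. }
split.
- apply is_derive_eq with (1 := is_derive_div _ _ _ _ _ hp hd hn); field; exact hn.
- apply is_derive_eq with (1 := is_derive_div _ _ _ _ _ (is_derive_Ropp _ _ _ hq) hd hn).
  field; exact hn.
Qed.

Lemma is_hol_inv (f : C -> C) (z l : C) :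
  is_hol f z l -> f z <> 0 -> is_hol (fun z => / f z)%C z (- (l * (/ f z * / f z))).
Proof.
destruct z as [x y]; intros [[h1 h2] [h3 h4]] hz.
apply Cneq_0_norm2 in hz.
destruct (is_derive_re_im_inv _ _ _ _ _ h1 h2 hz) as [k1 k2].
destruct (is_derive_re_im_inv _ _ _ _ _ h3 h4 hz) as [k3 k4].
split; split.
- apply is_derive_eq with (1 := k1); revert hz; unfold Re, Im; simpl; intros; field; lra.
- apply is_derive_eq with (1 := k2); revert hz; unfold Re, Im; simpl; intros; field; lra.
- apply is_derive_eq with (1 := k3); revert hz; unfold Re, Im; simpl; intros; field; lra.
- apply is_derive_eq with (1 := k4); revert hz; unfold Re, Im; simpl; intros; field; lra.
Qed.

Lemma holo_strip_const (c d : R) (a : C) : holo_strip c d (fun _ => a).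
Proof.
exists (fun _ => 0); intros z _; split; [|split]; try apply cont2_const.
split; split; try apply (is_derive_const (K := R_AbsRing) (V := R_NormedModule)).
simpl; rewrite Ropp_0; apply (is_derive_const (K := R_AbsRing) (V := R_NormedModule)).
Qed.

Lemma holo_strip_id (c d : R) : holo_strip c d (fun z => z).
Proof.
exists (fun _ => 1); intros z _; split; [apply cont2_id|]; split; [apply cont2_const|].
split; split; simpl.
- exact (is_derive_id (K := R_AbsRing) (Re z)).
- apply (is_derive_const (K := R_AbsRing) (V := R_NormedModule)).
- rewrite Ropp_0; apply (is_derive_const (K := R_AbsRing) (V := R_NormedModule)).
- exact (is_derive_id (K := R_AbsRing) (Im z)).
Qed.

Lemma holo_strip_opp (c d : R) (f : C -> C) :
  holo_strip c d f -> holo_strip c d (fun z => - f z)%C.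
Proof.
intros [f' hf]; exists (fun z => - f' z)%C; intros z hz.
destruct (hf z hz) as (h1 & h2 & h3).
split; [|split]; [now apply cont2_opp..|now apply is_hol_opp].
Qed.

Lemma holo_strip_plus (c d : R) (f g : C -> C) :
  holo_strip c d f -> holo_strip c d g -> holo_strip c d (fun z => f z + g z)%C.
Proof.
intros [f' hf] [g' hg]; exists (fun z => f' z + g' z)%C; intros z hz.
destruct (hf z hz) as (h1 & h2 & h3), (hg z hz) as (k1 & k2 & k3).
split; [|split]; [now apply cont2_plus..|now apply is_hol_plus].
Qed.

Lemma holo_strip_minus (c d : R) (f g : C -> C) :
  holo_strip c d f -> holo_strip c d g -> holo_strip c d (fun z => f z - g z)%C.
Proof. intros; apply holo_strip_plus; [|apply holo_strip_opp]; assumption. Qed.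

Lemma holo_strip_mult (c d : R) (f g : C -> C) :
  holo_strip c d f -> holo_strip c d g -> holo_strip c d (fun z => f z * g z)%C.
Proof.
intros [f' hf] [g' hg]; exists (fun z => f' z * g z + f z * g' z)%C; intros z hz.
destruct (hf z hz) as (h1 & h2 & h3), (hg z hz) as (k1 & k2 & k3).
split; [|split]; [now apply cont2_mult| |now apply is_hol_mult].
apply cont2_plus; now apply cont2_mult.
Qed.

Lemma holo_strip_inv (c d : R) (f : C -> C) :
  holo_strip c d f -> (forall z, c < Im z < d -> f z <> 0) ->
  holo_strip c d (fun z => / f z)%C.
Proof.
intros [f' hf] hz; exists (fun z => - (f' z * (/ f z * / f z)))%C; intros z hs.
destruct (hf z hs) as (h1 & h2 & h3); specialize (hz z hs).
split; [|split]; [now apply cont2_inv| |now apply is_hol_inv].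
apply cont2_opp, cont2_mult; [exact h2|]; apply cont2_mult; now apply cont2_inv.
Qed.

Lemma holo_strip_div (c d : R) (f g : C -> C) :
  holo_strip c d f -> holo_strip c d g ->
  (forall z, c < Im z < d -> g z <> 0) -> holo_strip c d (fun z => f z / g z)%C.
Proof. intros; apply holo_strip_mult; [|apply holo_strip_inv]; assumption. Qed.

Lemma holo_strip_ext (c d : R) (f g : C -> C) :
  (forall z, c < Im z < d -> f z = g z) -> holo_strip c d f -> holo_strip c d g.
Proof.
intros he [f' hf]; exists f'; intros [x y] hz.
destruct (hf _ hz) as ([h1 h2] & h3 & [[k1 k2] [k3 k4]]).
assert (loc := locally_interval c d y hz); destruct loc as [r hr].
split; [split|split; [exact h3|]].
- apply continuity_2d_pt_ext_loc with (2 := h1).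
  exists r; intros u v _ hv; rewrite he; [reflexivity|]; now apply hr.
- apply continuity_2d_pt_ext_loc with (2 := h2).
  exists r; intros u v _ hv; rewrite he; [reflexivity|]; now apply hr.
- split; split.
  + apply (is_derive_ext (V := R_NormedModule)) with (2 := k1).
    intros t; now rewrite he.
  + apply (is_derive_ext (V := R_NormedModule)) with (2 := k2).
    intros t; now rewrite he.
  + apply (is_derive_ext_loc (V := R_NormedModule)) with (2 := k3).
    exists r; intros v hv; rewrite he; [reflexivity|]; now apply hr.
  + apply (is_derive_ext_loc (V := R_NormedModule)) with (2 := k4).
    exists r; intros v hv; rewrite he; [reflexivity|]; now apply hr.
Qed.

Definition Cexp (z : C) : C := (exp (Re z) * cos (Im z), exp (Re z) * sin (Im z)).

Lemma cont2_Cexp (z : C) : cont2 Cexp z.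
Proof.
assert (h1 : continuity_2d_pt (fun x y => exp x) (Re z) (Im z)).
{ apply continuity_1d_2d_pt_comp, continuity_2d_pt_id1.
  apply derivable_continuous_pt, derivable_pt_exp. }
split; apply continuity_2d_pt_mult; try exact h1;
  apply continuity_1d_2d_pt_comp, continuity_2d_pt_id2;
  [apply continuity_cos | apply continuity_sin].
Qed.

Lemma holo_strip_Cexp (c d : R) : holo_strip c d Cexp.
Proof.
exists Cexp; intros [x y] _; split; [apply cont2_Cexp|]; split; [apply cont2_Cexp|].
split; split; unfold Cexp, Re, Im; simpl; auto_derive; trivial; ring.
Qed.

(** The Cauchy-Riemann equations say that Re P and -Im P share the mixed partial -Im P', and that Im
    P and Re P share Re P'. Each pair is an instance of [Green_rectangle]. *)
Lemma holo_strip_rect (P : C -> C) (a b c d : R) :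
  a <= b -> c <= d ->
  (forall z, c <= Im z <= d -> cont2 P z) -> holo_strip c d P ->
  RInt (fun x => Re (P (x, d))) a b - RInt (fun x => Re (P (x, c))) a b =
  RInt (fun y => - (Im (P (b, y)) - Im (P (a, y)))) c d /\
  RInt (fun x => Im (P (x, d))) a b - RInt (fun x => Im (P (x, c))) a b =
  RInt (fun y => Re (P (b, y)) - Re (P (a, y))) c d.
Proof.
intros hab hcd hc [P' hP]; split.
- rewrite (Green_rectangle (fun x y => Re (P (x, y))) (fun x y => - Im (P (x, y)))
             (fun x y => - Im (P' (x, y))));
    [apply RInt_ext; intros y _; lra|exact hab|exact hcd| | |].
  + intros x y hy; now apply (hc (x, y)).
  + intros x y hy; apply continuity_2d_pt_opp; now apply (hc (x, y)).
  + intros x y hy; destruct (hP (x, y) hy) as (h1 & h2 & [[k1 k2] [k3 k4]]).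
    split; [exact k3|split].
    * now apply is_derive_Ropp.
    * apply continuity_2d_pt_opp, h2.
- rewrite (Green_rectangle (fun x y => Im (P (x, y))) (fun x y => Re (P (x, y)))
             (fun x y => Re (P' (x, y)))); [reflexivity|exact hab|exact hcd| | |].
  + intros x y hy; now apply (hc (x, y)).
  + intros x y hy; now apply (hc (x, y)).
  + intros x y hy; destruct (hP (x, y) hy) as (h1 & h2 & [[k1 k2] [k3 k4]]).
    split; [exact k4|split; [exact k1|apply h2]].
Qed.

(** * Difference quotients of the exponential *)

Lemma Cexp_plus (a b : C) : Cexp (a + b) = (Cexp a * Cexp b)%C.
Proof.
apply injective_projections; unfold Cexp, Re, Im; simpl;
  rewrite exp_plus, ?cos_plus, ?sin_plus; ring.
Qed.

Lemma Cexp_0 : Cexp 0 = 1.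
Proof.
apply injective_projections; unfold Cexp, Re, Im; simpl;
  rewrite exp_0, ?cos_0, ?sin_0; ring.
Qed.

Lemma Cmod_Cexp (z : C) : Cmod (Cexp z) = exp (Re z).
Proof.
unfold Cmod, Cexp; simpl.
replace (_ + _) with (Rsqr (exp (Re z))).
- rewrite sqrt_Rsqr; [reflexivity|]; apply Rlt_le, exp_pos.
- generalize (sin2_cos2 (Im z)); unfold Rsqr; intros h.
  replace (exp (Re z) * exp (Re z)) with
    (exp (Re z) * exp (Re z) * (sin (Im z) * sin (Im z) + cos (Im z) * cos (Im z)))
    by (rewrite h; ring).
  ring.
Qed.

Lemma Cexp_neq_0 (z : C) : Cexp z <> 0.
Proof. apply Cmod_gt_0; rewrite Cmod_Cexp; apply exp_pos. Qed.

(** Since 1 - cos y = 2 sin(y/2)^2, the claim reduces to the zeros of sine on (-PI, PI). *)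
Lemma cos_eq_1_0 (y : R) : Rabs y < 2 * PI -> cos y = 1 -> y = 0.
Proof.
intros hy h.
assert (hs : sin (y / 2) = 0).
{ replace y with (2 * (y / 2)) in h by field.
  rewrite cos_2a_sin in h; nra. }
apply Rabs_lt_between in hy.
destruct (Rtotal_order y 0) as [hn|[h0|hp]]; [|exact h0|].
- assert (0 < sin (- (y / 2))) by (apply sin_gt_0; lra).
  rewrite sin_neg in *; lra.
- assert (0 < sin (y / 2)) by (apply sin_gt_0; lra); lra.
Qed.

(** Moduli give equal real parts, and the quotient then gives the angle. The bound 2 PI allows one
    point on the edge of the closed strip if the other is strictly inside. *)
Lemma Cexp_inj (a b : C) :
  Rabs (Im a - Im b) < 2 * PI -> Cexp a = Cexp b -> a = b.
Proof.
intros hi h.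
assert (hr : Re a = Re b).
{ apply exp_inv; now rewrite <- !Cmod_Cexp, h. }
assert (hc : Cexp (a - b) = 1).
{ replace (RtoC 1) with (Cexp (b - b)).
  - unfold Cminus; now rewrite !Cexp_plus, h.
  - replace (b - b)%C with (RtoC 0) by ring; exact Cexp_0. }
apply (f_equal Re) in hc.
change (exp (Re a + - Re b) * cos (Im a - Im b) = 1) in hc.
rewrite hr, Rplus_opp_r, exp_0, Rmult_1_l in hc.
apply cos_eq_1_0 in hc; [|exact hi].
apply injective_projections; [exact hr|]; unfold Im in hc; lra.
Qed.

Lemma Rabs_sin_le (y : R) : Rabs (sin y) <= Rabs y.
Proof.
destruct (MVT_gen sin 0 y cos) as [c [_ h]].
- intros; apply is_derive_sin.
- intros; apply continuity_sin.
- rewrite sin_0, !Rminus_0_r in h; rewrite h, Rabs_mult.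
  assert (Rabs (cos c) <= 1) by (apply Rabs_le, COS_bound).
  generalize (Rabs_pos y); nra.
Qed.

Lemma cos_1_bound (y : R) : 0 <= 1 - cos y <= y ^ 2 / 2.
Proof.
replace (cos y) with (cos (2 * (y / 2))) by (f_equal; field).
rewrite cos_2a_sin.
assert (h := Rabs_sin_le (y / 2)); apply Rsqr_le_abs_1 in h; unfold Rsqr in h.
nra.
Qed.

Lemma sin_sub_bound (y : R) : Rabs y <= 1 -> Rabs (sin y - y) <= y ^ 2.
Proof.
intros hy.
destruct (MVT_gen (fun y => sin y - y) 0 y (fun y => cos y - 1)) as [c [hc h]].
- intros; auto_derive; trivial; ring.
- intros; apply continuity_pt_minus; [apply continuity_sin|].
  apply derivable_continuous_pt, derivable_pt_id.
- rewrite sin_0, !Rminus_0_r in h; rewrite h, Rabs_mult.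
  assert (hb := cos_1_bound c).
  assert (hcy : c ^ 2 <= y ^ 2).
  { revert hc; unfold Rmin, Rmax; destruct Rle_dec; intros; nra. }
  rewrite Rabs_minus_sym, (Rabs_pos_eq (1 - cos c)) by lra.
  generalize (Rabs_pos y); intros; rewrite <- (pow2_abs y) in *; nra.
Qed.

(** From exp(-x) >= 1 - x one gets exp x (1 - x) <= 1, while (1 + x + 2x^2)(1 - x) = 1 + x^2 (1 -
    2x) >= 1. *)
Lemma exp_taylor_bound (x : R) : Rabs x <= / 2 -> 0 <= exp x - 1 - x <= 2 * x ^ 2.
Proof.
intros hx; apply Rabs_le_between in hx.
assert (h1 := exp_ineq1_le x); assert (h2 := exp_ineq1_le (- x)).
split; [lra|].
assert (h3 : exp x * exp (- x) = 1) by (rewrite <- exp_plus, Rplus_opp_r; apply exp_0).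
generalize (exp_pos x); intros; nra.
Qed.

Lemma Cmod_le_Rabs (z : C) : Cmod z <= Rabs (Re z) + Rabs (Im z).
Proof.
unfold Cmod; apply Rsqr_incr_0_var.
- rewrite Rsqr_sqrt by nra; unfold Rsqr.
  change (fst z) with (Re z); change (snd z) with (Im z).
  rewrite <- (pow2_abs (Re z)), <- (pow2_abs (Im z)).
  generalize (Rabs_pos (Re z)) (Rabs_pos (Im z)); nra.
- generalize (Rabs_pos (Re z)) (Rabs_pos (Im z)); lra.
Qed.

Lemma im_le_Cmod (z : C) : Rabs (Im z) <= Cmod z.
Proof. apply Rle_trans with (2 := Rmax_Cmod z), Rmax_r. Qed.

(** A quadratic remainder makes the difference quotient of exp Lipschitz at its removable point. The
    constant 8 is generous. *)
Lemma Cexp_taylor_bound (h : C) :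
  Cmod h <= / 2 -> Cmod (Cexp h - 1 - h) <= 8 * Cmod h ^ 2.
Proof.
intros hh.
assert (hx := Rle_trans _ _ _ (re_le_Cmod h) hh).
assert (hy := Rle_trans _ _ _ (im_le_Cmod h) hh).
rewrite Cmod2_alt.
apply Rle_trans with (1 := Cmod_le_Rabs _).
destruct h as [x y]; unfold Re, Im in *; simpl fst in *; simpl snd in *.
assert (e1 := exp_taylor_bound x hx).
assert (e2 := cos_1_bound y).
assert (e3 : Rabs (sin y - y) <= y ^ 2) by (apply sin_sub_bound; lra).
assert (e4 := Rabs_sin_le y).
assert (e5 : Rabs (exp x - 1) <= 2 * Rabs x).
{ replace (exp x - 1) with (exp x - 1 - x + x) by ring.
  apply Rle_trans with (1 := Rabs_triang _ _).
  rewrite (Rabs_pos_eq (exp x - 1 - x)) by lra.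
  rewrite <- (pow2_abs x) in e1; generalize (Rabs_pos x); nra. }
assert (e6 : Rabs (exp x - 1 - x) <= 2 * x ^ 2) by (apply Rabs_le; lra).
assert (e7 : Rabs (cos y - 1) <= y ^ 2 / 2) by (apply Rabs_le; lra).
assert (e8 : Rabs (cos y) <= 1) by (apply Rabs_le, COS_bound).
assert (e9 : Rabs (1 + x) <= 2) by (apply Rabs_le; apply Rabs_le_between in hx; lra).
replace (exp x * cos y + - (1) + - x) with
  ((exp x - 1 - x) * cos y + (1 + x) * (cos y - 1)) by ring.
replace (exp x * sin y + - (0) + - y) with
  ((exp x - 1) * sin y + (sin y - y)) by ring.
assert (t1 := Rabs_triang ((exp x - 1 - x) * cos y) ((1 + x) * (cos y - 1))).
assert (t2 := Rabs_triang ((exp x - 1) * sin y) (sin y - y)).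
rewrite !Rabs_mult in t1; rewrite Rabs_mult in t2.
assert (m1 : Rabs (exp x - 1 - x) * Rabs (cos y) <= 2 * x ^ 2 * 1)
  by (apply Rmult_le_compat; auto using Rabs_pos).
assert (m2 : Rabs (1 + x) * Rabs (cos y - 1) <= 2 * (y ^ 2 / 2))
  by (apply Rmult_le_compat; auto using Rabs_pos).
assert (m3 : Rabs (exp x - 1) * Rabs (sin y) <= 2 * Rabs x * Rabs y)
  by (apply Rmult_le_compat; auto using Rabs_pos).
rewrite <- (pow2_abs x), <- (pow2_abs y) in *.
generalize (Rabs_pos x) (Rabs_pos y); nra.
Qed.

Definition exp_slope (c z : C) : C :=
  if Ceq_dec z c then Cexp c else ((Cexp z - Cexp c) / (z - c))%C.

Lemma exp_slope_off (c z : C) :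
  z <> c -> exp_slope c z = ((Cexp z - Cexp c) / (z - c))%C.
Proof. intros h; unfold exp_slope; now destruct Ceq_dec. Qed.

(** Away from [c] this is injectivity of exp; at [c] the value is the derivative exp c. *)
Lemma exp_slope_neq_0 (c z : C) :
  Rabs (Im z - Im c) < 2 * PI -> exp_slope c z <> 0.
Proof.
intros hi; unfold exp_slope; destruct Ceq_dec as [_|h]; [apply Cexp_neq_0|].
apply Cmult_neq_0.
- apply Cminus_eq_contra; intros e; now apply h, Cexp_inj.
- intros e; apply (Cminus_eq_contra _ _ h).
  rewrite <- (Cmult_1_r (z - c)), <- (Cinv_r (z - c)) by now apply Cminus_eq_contra.
  rewrite e; ring.
Qed.

Lemma cont2_ext_loc (f g : C -> C) (z : C) :
  locally_2d (fun x y => f (x, y) = g (x, y)) (Re z) (Im z) ->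
  cont2 f z -> cont2 g z.
Proof.
intros he [h1 h2]; split.
- apply continuity_2d_pt_ext_loc with (2 := h1).
  apply locally_2d_impl with (2 := he), locally_2d_forall; now intros u v ->.
- apply continuity_2d_pt_ext_loc with (2 := h2).
  apply locally_2d_impl with (2 := he), locally_2d_forall; now intros u v ->.
Qed.

Lemma cont2_neq (f : C -> C) (a z : C) :
  cont2 f z -> f z <> a -> locally_2d (fun x y => f (x, y) <> a) (Re z) (Im z).
Proof.
intros hf hz.
assert (hm : cont2 (fun z => f z - a)%C z) by (apply cont2_minus; [exact hf | apply cont2_const]).
destruct hm as [h1 h2].
assert (hn := continuity_2d_pt_plus _ _ _ _
  (continuity_2d_pt_mult _ _ _ _ h1 h1) (continuity_2d_pt_mult _ _ _ _ h2 h2)).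
apply continuity_2d_pt_neq_0 in hn.
- apply locally_2d_impl with (2 := hn), locally_2d_forall; intros u v h e.
  apply h; rewrite e; unfold Re, Im; simpl; ring.
- destruct z as [x y]; apply Cminus_eq_contra, Cneq_0_norm2 in hz.
  unfold Re, Im in *; simpl in *; lra.
Qed.

Lemma cont2_lipschitz (f : C -> C) (z : C) (K r : R) :
  0 < r -> (forall w, Cmod (w - z) <= r -> Cmod (f w - f z) <= K * Cmod (w - z)) ->
  cont2 f z.
Proof.
intros hr hK.
assert (H : forall eps : posreal,
  locally_2d (fun x y => Cmod (f (x, y) - f z) < eps) (Re z) (Im z)).
{ intros eps.
  assert (hK' : 0 < Rabs K + 1) by (generalize (Rabs_pos K); lra).
  (* [locally_2d] works with squares, where the modulus is at most twice the larger coordinate,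
     hence the factors 2. [Rabs K + 1] is positive whatever the sign of [K]. *)
  assert (hd : 0 < Rmin (r / 2) (eps / (2 * (Rabs K + 1)))).
  { apply Rmin_glb_lt; [lra|]; apply Rdiv_lt_0_compat; [apply cond_pos | lra]. }
  exists (mkposreal _ hd); simpl; intros u v hu hv.
  assert (hc : Cmod ((u, v) - z) <= 2 * Rmin (r / 2) (eps / (2 * (Rabs K + 1)))).
  { apply Rle_trans with (1 := Cmod_le_Rabs _).
    unfold Re, Im in *; simpl; unfold Rminus in *; lra. }
  assert (l1 := Rmin_l (r / 2) (eps / (2 * (Rabs K + 1)))).
  assert (l2 := Rmin_r (r / 2) (eps / (2 * (Rabs K + 1)))).
  apply Rle_lt_trans with (1 := hK (u, v) ltac:(lra)).
  assert (hs : Cmod ((u, v) - z) * (Rabs K + 1) <= eps).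
  { replace (pos eps) with (2 * (eps / (2 * (Rabs K + 1))) * (Rabs K + 1))
      by (field; lra).
    apply Rmult_le_compat_r; lra. }
  generalize (Cmod_ge_0 ((u, v) - z)) (Rle_abs K) (cond_pos eps); intros.
  destruct (Req_dec (Cmod ((u, v) - z)) 0) as [e|e].
  - rewrite e, Rmult_0_r; lra.
  - nra. }
split; intros eps; apply locally_2d_impl with (2 := H eps), locally_2d_forall;
  intros u v h; apply Rle_lt_trans with (2 := h).
- destruct z; apply (re_le_Cmod (f (u, v) - f (_, _))).
- destruct z; apply (im_le_Cmod (f (u, v) - f (_, _))).
Qed.

(** At [c], factoring out exp c turns the increment into the Taylor remainder of exp at 0 divided by
    w - c, which gives the Lipschitz constant 8 |exp c|. *)
Lemma cont2_exp_slope (c z : C) : cont2 (exp_slope c) z.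
Proof.
destruct (Ceq_dec z c) as [->|h].
- apply cont2_lipschitz with (K := 8 * Cmod (Cexp c)) (r := / 2); [lra|].
  intros w hw; unfold exp_slope at 2; destruct (Ceq_dec c c) as [_|[]]; [|reflexivity].
  unfold exp_slope; destruct (Ceq_dec w c) as [->|hn].
  + unfold Cminus; rewrite !Cplus_opp_r, Cmod_0; lra.
  + assert (hm := Cminus_eq_contra _ _ hn).
    replace (Cexp w) with (Cexp c * Cexp (w - c))%C
      by (rewrite <- Cexp_plus; f_equal; ring).
    replace ((Cexp c * Cexp (w - c) - Cexp c) / (w - c) - Cexp c)%C
      with (Cexp c * ((Cexp (w - c) - 1 - (w - c)) / (w - c)))%C
      by (field; exact hm).
    rewrite Cmod_mult, Cmod_div by exact hm.
    rewrite (Rmult_comm 8), Rmult_assoc; apply Rmult_le_compat_l; [apply Cmod_ge_0|].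
    apply Cmod_gt_0 in hm.
    apply Rmult_le_reg_r with (1 := hm).
    unfold Rdiv; rewrite Rmult_assoc, Rinv_l, Rmult_1_r by lra.
    replace (8 * Cmod (w - c) * Cmod (w - c)) with (8 * Cmod (w - c) ^ 2) by ring.
    now apply Cexp_taylor_bound.
- apply cont2_ext_loc with (fun z => (Cexp z - Cexp c) / (z - c))%C.
  + apply locally_2d_impl with (2 := cont2_neq _ c z (cont2_id z) h).
    apply locally_2d_forall; intros u v hn; symmetry; now apply exp_slope_off.
  + apply cont2_div; [| |now apply Cminus_eq_contra];
      apply cont2_minus; auto using cont2_const, cont2_id, cont2_Cexp.
Qed.

(* With [w = exp z] and [a = exp c], [log_slope c z] is
   [w (log w - log a) / (w - a)], so that
   [(w log w - a log a) / (w - a) = c + log_slope c z]. *)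
Definition log_slope (c z : C) : C := (Cexp z / exp_slope c z)%C.

Lemma log_slope_off (c z : C) :
  z <> c -> Cexp z <> Cexp c ->
  log_slope c z = (Cexp z * (z - c) / (Cexp z - Cexp c))%C.
Proof.
intros h he; unfold log_slope; rewrite exp_slope_off by exact h.
field; split; now apply Cminus_eq_contra.
Qed.

Lemma cont2_log_slope (c z : C) :
  Rabs (Im z - Im c) < 2 * PI -> cont2 (log_slope c) z.
Proof.
intros h; apply cont2_div; [apply cont2_Cexp | apply cont2_exp_slope |].
now apply exp_slope_neq_0.
Qed.

(** A strip missing the line Im z = Im c misses the removable point, so the plain quotient formula
    holds throughout. *)
Lemma holo_log_slope (a b : R) (c : C) :
  (forall y, a < y < b -> y <> Im c /\ Rabs (y - Im c) < 2 * PI) ->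
  holo_strip a b (log_slope c).
Proof.
intros h.
assert (hn : forall z, a < Im z < b -> z <> c /\ Cexp z <> Cexp c).
{ intros z hz; destruct (h _ hz) as [h1 h2]; split.
  - now intros ->.
  - intros e; apply Cexp_inj in e; [|exact h2]; now subst. }
apply holo_strip_ext with (fun z => Cexp z * (z - c) / (Cexp z - Cexp c))%C.
- intros z hz; destruct (hn z hz); symmetry; now apply log_slope_off.
- apply holo_strip_div.
  + apply holo_strip_mult; [apply holo_strip_Cexp|].
    apply holo_strip_minus; [apply holo_strip_id | apply holo_strip_const].
  + apply holo_strip_minus; [apply holo_strip_Cexp | apply holo_strip_const].
  + intros z hz; now apply Cminus_eq_contra, hn.
Qed.

(** * The function G and the zero of 2L - w log w *)

Lemma ln2_pos : 0 < ln2.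
Proof. unfold ln2; rewrite <- ln_1; apply ln_increasing; lra. Qed.

Lemma Cexp_ln2 : Cexp ln2 = 2.
Proof.
apply injective_projections; unfold Cexp, Re, Im; simpl;
  rewrite ?cos_0, ?sin_0; unfold ln2; rewrite exp_ln; lra.
Qed.

(** A positive value of x exp x forces x > 0, and there the function is strictly increasing. *)
Lemma x_exp_x_inj (x y : R) : 0 < y -> x * exp x = y * exp y -> x = y.
Proof.
intros hy h.
assert (hx : 0 < x).
{ generalize (exp_pos x) (exp_pos y); intros.
  assert (0 < y * exp y) by now apply Rmult_lt_0_compat.
  apply Rmult_lt_reg_r with (exp x); lra. }
destruct (Rtotal_order x y) as [l|[e|l]]; [|exact e|]; exfalso;
  generalize (exp_increasing _ _ l) (exp_pos x) (exp_pos y); intros; nra.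
Qed.

(* On the closed strip, [w log w] takes the value [2 ln 2] only at [w = 2]: for
   [z = x + i y], [Im (z exp z) = 0] gives [Re (z exp z) * sin y = - y exp x],
   which forces [y = 0]. *)
Lemma z_Cexp_neq (z : C) :
  Rabs (Im z) <= PI -> z <> ln2 -> (z * Cexp z)%C <> (2 * ln2)%C.
Proof.
intros hi hz h; apply hz.
assert (hr := f_equal Re h); assert (hm := f_equal Im h).
destruct z as [x y]; unfold Cexp, Re, Im in *; simpl in *.
assert (hL := ln2_pos); assert (hx := exp_pos x).
assert (key : 2 * ln2 * sin y = - y * exp x).
{ generalize (sin2_cos2 y); unfold Rsqr; intros hsc.
  replace (2 * ln2) with (x * (exp x * cos y) - y * (exp x * sin y)) by lra.
  assert (x * (exp x * sin y) = - (y * (exp x * cos y))) by lra.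
  transitivity (x * (exp x * sin y) * cos y - y * exp x * (sin y * sin y)); [ring|].
  rewrite H; transitivity (- y * exp x * (sin y * sin y + cos y * cos y)); [ring|].
  rewrite hsc; ring. }
assert (y0 : y = 0).
{ apply Rabs_le_between in hi.
  destruct (Rtotal_order y 0) as [l|[e|l]]; [|exact e|]; exfalso.
  - assert (0 <= sin (- y)) by (apply sin_ge_0; lra); rewrite sin_neg in *; nra.
  - assert (0 <= sin y) by (apply sin_ge_0; lra); nra. }
subst y; rewrite cos_0, sin_0 in hr.
assert (x = ln2); [|now subst].
apply x_exp_x_inj; [exact hL|]; unfold ln2 at 2; rewrite exp_ln; lra.
Qed.

(* The removable-singularity-free form of [(2 - w) / (2 ln 2 - w log w)]. *)
Definition G (z : C) : C := (/ (ln2 + log_slope ln2 z))%C.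

Lemma RtoC_neq_0 (x : R) : x <> 0 -> RtoC x <> 0.
Proof. intros h e; apply h; now apply (f_equal Re) in e. Qed.

Lemma Cexp_neq_2 (z : C) : Rabs (Im z) <= PI -> z <> ln2 -> Cexp z <> 2.
Proof.
intros hi hz; rewrite <- Cexp_ln2; intros e; apply hz, Cexp_inj; [|exact e].
simpl; rewrite Rminus_0_r; generalize PI_RGT_0; lra.
Qed.

(** Away from log 2 the expression is (z exp z - 2L)/(exp z - 2), whose numerator [z_Cexp_neq]
    controls; at log 2 it is L + 1. *)
Lemma G_den_neq_0 (z : C) : Rabs (Im z) <= PI -> (ln2 + log_slope ln2 z)%C <> 0.
Proof.
intros hi; assert (hL := ln2_pos); destruct (Ceq_dec z ln2) as [->|h].
- unfold log_slope, exp_slope; destruct Ceq_dec as [_|[]]; [|reflexivity].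
  rewrite Cexp_ln2; replace (ln2 + 2 / 2)%C with (RtoC (ln2 + 1)).
  + apply RtoC_neq_0; lra.
  + rewrite RtoC_plus; f_equal; field; apply RtoC_neq_0; lra.
- assert (h2 := Cexp_neq_2 z hi h).
  rewrite log_slope_off by (try rewrite Cexp_ln2; assumption).
  rewrite Cexp_ln2.
  replace (ln2 + Cexp z * (z - ln2) / (Cexp z - 2))%C
    with ((z * Cexp z - 2 * ln2) / (Cexp z - 2))%C
    by (field; now apply Cminus_eq_contra).
  apply Cmult_neq_0; [now apply Cminus_eq_contra, z_Cexp_neq|].
  apply Cminus_eq_contra in h2; intros e; apply C1_nz.
  now rewrite <- (Cinv_r _ h2), e, Cmult_0_r.
Qed.

Lemma G_off (z : C) :
  Rabs (Im z) <= PI -> z <> ln2 ->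
  G z = ((2 - Cexp z) / (2 * ln2 - z * Cexp z))%C.
Proof.
intros hi h; assert (h2 := Cexp_neq_2 z hi h); assert (h3 := z_Cexp_neq z hi h).
assert (h4 := G_den_neq_0 z hi); revert h4; unfold G.
rewrite log_slope_off by (try rewrite Cexp_ln2; assumption).
rewrite Cexp_ln2; intros h4.
assert (h5 := Cminus_eq_contra _ _ h2).
assert (h6 : (2 * ln2 - z * Cexp z)%C <> 0)
  by (apply Cminus_eq_contra; intros e; now apply h3).
field; repeat split; try assumption.
intros e; apply h6; rewrite <- Ropp_0, RtoC_opp, <- e; ring.
Qed.

(** * Cauchy's theorem for the divided difference *)

Lemma is_RInt_C (f : R -> C) (a b : R) (l : C) :
  is_RInt (fun t => Re (f t)) a b (Re l) -> is_RInt (fun t => Im (f t)) a b (Im l) ->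
  @is_RInt C_R_NormedModule f a b l.
Proof.
destruct l as [lr li].
exact (is_RInt_fct_extend_pair (U := R_NormedModule) (V := R_NormedModule) f a b lr li).
Qed.

Lemma cont2_continuous_l (f : C -> C) (x y : R) :
  cont2 f (x, y) ->
  continuous (fun u => Re (f (u, y))) x /\ continuous (fun u => Im (f (u, y))) x.
Proof.
intros [h1 h2]; split.
- exact (continuity_2d_pt_continuous_l _ _ _ h1).
- exact (continuity_2d_pt_continuous_l _ _ _ h2).
Qed.

Lemma cont2_continuous_r (f : C -> C) (x y : R) :
  cont2 f (x, y) ->
  continuous (fun v => Re (f (x, v))) y /\ continuous (fun v => Im (f (x, v))) y.
Proof.
intros [h1 h2]; split.
- exact (continuity_2d_pt_continuous_r _ _ _ h1).
- exact (continuity_2d_pt_continuous_r _ _ _ h2).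
Qed.

Lemma ex_RInt_rect_vertical (P : C -> C) (c d x p q : R) :
  (forall z, c <= Im z <= d -> cont2 P z) ->
  c <= p -> p <= q -> q <= d ->
  ex_RInt (fun y => Re (P (x, y))) p q /\ ex_RInt (fun y => Im (P (x, y))) p q.
Proof.
intros hc h1 h2 h3; split; apply (ex_RInt_continuous (V := R_CompleteNormedModule));
  rewrite Rmin_left, Rmax_right by exact h2; intros y hy;
  destruct (cont2_continuous_r P x y (hc (x, y) ltac:(simpl; lra))); assumption.
Qed.

Lemma ex_RInt_rect_horizontal (P : C -> C) (a b y : R) :
  a <= b -> (forall x, cont2 P (x, y)) ->
  ex_RInt (fun x => Re (P (x, y))) a b /\ ex_RInt (fun x => Im (P (x, y))) a b.
Proof.
intros hab hc; split; apply (ex_RInt_continuous (V := R_CompleteNormedModule));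
  rewrite Rmin_left, Rmax_right by exact hab; intros x hx;
  destruct (cont2_continuous_l P x y (hc x)); assumption.
Qed.

(* Continuity makes two exceptional horizontal lines harmless. *)
Lemma Cauchy_rect (P : C -> C) (a b c d m n : R) :
  a <= b -> c <= d -> (forall z, c <= Im z <= d -> cont2 P z) ->
  c <= m -> m <= n -> n <= d ->
  holo_strip c m P -> holo_strip m n P -> holo_strip n d P ->
  exists V : C,
    @is_RInt C_R_NormedModule (fun x => P (x, d) - P (x, c))%C a b V /\
    @is_RInt C_R_NormedModule (fun y => Ci * (P (b, y) - P (a, y)))%C c d V.
Proof.
intros hab hcd hc h1 h2 h3 k1 k2 k3.
destruct (holo_strip_rect P a b c m) as [e1 f1]; auto.
{ intros; apply hc; lra. }
destruct (holo_strip_rect P a b m n) as [e2 f2]; auto.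
{ intros; apply hc; lra. }
destruct (holo_strip_rect P a b n d) as [e3 f3]; auto.
{ intros; apply hc; lra. }
destruct (ex_RInt_rect_horizontal P a b c hab) as [hc1 hc2]; [intros; apply hc; simpl; lra|].
destruct (ex_RInt_rect_horizontal P a b d hab) as [hd1 hd2]; [intros; apply hc; simpl; lra|].
exists (RInt (fun y => - (Im (P (b, y)) - Im (P (a, y)))) c d,
        RInt (fun y => Re (P (b, y)) - Re (P (a, y))) c d).
assert (exI : forall p q, c <= p -> p <= q -> q <= d ->
  ex_RInt (fun y => - (Im (P (b, y)) - Im (P (a, y)))) p q).
{ intros p q p1 p2 p3; apply (ex_RInt_opp (V := R_NormedModule)).
  destruct (ex_RInt_rect_vertical P c d a p q hc p1 p2 p3),
    (ex_RInt_rect_vertical P c d b p q hc p1 p2 p3).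
  now apply (ex_RInt_minus (V := R_NormedModule)). }
assert (exR : forall p q, c <= p -> p <= q -> q <= d ->
  ex_RInt (fun y => Re (P (b, y)) - Re (P (a, y))) p q).
{ intros p q p1 p2 p3.
  destruct (ex_RInt_rect_vertical P c d a p q hc p1 p2 p3),
    (ex_RInt_rect_vertical P c d b p q hc p1 p2 p3).
  now apply (ex_RInt_minus (V := R_NormedModule)). }
assert (eI : RInt (fun y => - (Im (P (b, y)) - Im (P (a, y)))) c d =
  RInt (fun x => Re (P (x, d))) a b - RInt (fun x => Re (P (x, c))) a b).
{ rewrite <- (RInt_Chasles (V := R_CompleteNormedModule) _ c m d) by (apply exI; lra).
  rewrite <- (RInt_Chasles (V := R_CompleteNormedModule) _ m n d) by (apply exI; lra).
  unfold plus; simpl; lra. }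
assert (eR : RInt (fun y => Re (P (b, y)) - Re (P (a, y))) c d =
  RInt (fun x => Im (P (x, d))) a b - RInt (fun x => Im (P (x, c))) a b).
{ rewrite <- (RInt_Chasles (V := R_CompleteNormedModule) _ c m d) by (apply exR; lra).
  rewrite <- (RInt_Chasles (V := R_CompleteNormedModule) _ m n d) by (apply exR; lra).
  unfold plus; simpl; lra. }
split; apply is_RInt_C.
- rewrite eI; apply (is_RInt_minus (V := R_NormedModule));
    now apply (RInt_correct (V := R_CompleteNormedModule)).
- rewrite eR; apply (is_RInt_minus (V := R_NormedModule));
    now apply (RInt_correct (V := R_CompleteNormedModule)).
- apply (is_RInt_ext (V := R_NormedModule)) with (fun y => - (Im (P (b, y)) - Im (P (a, y)))).
  + intros y _; unfold Re, Im; simpl; ring.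
  + apply (RInt_correct (V := R_CompleteNormedModule)), exI; lra.
- apply (is_RInt_ext (V := R_NormedModule)) with (fun y => Re (P (b, y)) - Re (P (a, y))).
  + intros y _; unfold Re, Im; simpl; ring.
  + apply (RInt_correct (V := R_CompleteNormedModule)), exR; lra.
Qed.

(* [Gdd c z] is [w] times the second divided difference of [G] at
   [w = exp z], [exp c] and [1]. *)
Definition Gdd (c z : C) : C :=
  (Cexp z * ((G z * (c + log_slope c z) - 1) / (2 * ln2 - c * Cexp c)
             - (G z * log_slope 0 z - 1) / (2 * ln2)) / (Cexp c - 1))%C.

(** These are the logarithms of w0 = 1 - z0: the open strip corresponds to the cut plane, and 0 and
    log 2 to the removable points z0 = 0 and z0 = -1. *)
Definition admissible (c : C) : Prop :=
  Rabs (Im c) < PI /\ c <> 0 /\ c <> ln2.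

Lemma admissible_neq (c : C) :
  admissible c ->
  (2 * ln2 - c * Cexp c)%C <> 0 /\ (Cexp c - 1)%C <> 0 /\ (2 * ln2)%C <> 0.
Proof.
intros (h1 & h2 & h3); assert (hL := ln2_pos).
split; [|split].
- apply Cminus_eq_contra; intros e; apply (z_Cexp_neq c); [lra|exact h3|now symmetry].
- apply Cminus_eq_contra; rewrite <- Cexp_0; intros e; apply h2, Cexp_inj; [|exact e].
  simpl; rewrite Rminus_0_r; generalize PI_RGT_0; lra.
- apply Cmult_neq_0; apply RtoC_neq_0; lra.
Qed.

(** As [c] is strictly inside the strip, Im z and Im c differ by less than 2 PI even on the edges,
    so [log_slope c] stays regular there. *)
Lemma cont2_Gdd (c z : C) :
  admissible c -> Rabs (Im z) <= PI -> cont2 (Gdd c) z.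
Proof.
intros hc hz; destruct (admissible_neq c hc) as (n1 & n2 & n3).
assert (hpi := PI_RGT_0).
assert (hG : cont2 G z).
{ apply cont2_inv; [|now apply G_den_neq_0].
  apply cont2_plus; [apply cont2_const|apply cont2_log_slope].
  simpl; rewrite Rminus_0_r; lra. }
assert (hl : cont2 (log_slope c) z).
{ apply cont2_log_slope; destruct hc as [h _].
  apply Rle_lt_trans with (1 := Rabs_triang _ _); rewrite Rabs_Ropp; lra. }
assert (h0 : cont2 (log_slope 0) z)
  by (apply cont2_log_slope; simpl; rewrite Rminus_0_r; lra).
unfold Gdd.
apply cont2_div; [|apply cont2_const|exact n2].
apply cont2_mult; [apply cont2_Cexp|].
apply cont2_minus; (apply cont2_div; [|apply cont2_const|assumption]);
  (apply cont2_minus; [apply cont2_mult; [exact hG|]|apply cont2_const]); [|exact h0].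
apply cont2_plus; [apply cont2_const|exact hl].
Qed.

(** The removable points 0 and log 2 lie on the real line, and [c] on the other excluded line. *)
Lemma holo_Gdd (a b : R) (c : C) :
  admissible c -> - PI <= a -> b <= PI ->
  (forall y, a < y < b -> y <> 0 /\ y <> Im c) -> holo_strip a b (Gdd c).
Proof.
intros hc ha hb hy; destruct (admissible_neq c hc) as (n1 & n2 & n3).
assert (hpi := PI_RGT_0).
assert (hR : forall x : R, holo_strip a b (log_slope x)).
{ intros x; apply holo_log_slope; intros y h; simpl; split; [now apply hy|].
  apply Rabs_lt_between; lra. }
assert (hl : holo_strip a b (log_slope c)).
{ apply holo_log_slope; intros y h; split; [now apply hy|].
  destruct hc as [h' _]; apply Rabs_lt_between in h'; apply Rabs_lt_between; lra. }
assert (hG : holo_strip a b G).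
{ apply holo_strip_inv.
  - apply holo_strip_plus; [apply holo_strip_const|apply hR].
  - intros z hz; apply G_den_neq_0, Rabs_le; lra. }
unfold Gdd.
apply holo_strip_div; [|apply holo_strip_const|intros; exact n2].
apply holo_strip_mult; [apply holo_strip_Cexp|].
apply holo_strip_minus;
  (apply holo_strip_div; [|apply holo_strip_const|intros; assumption]);
  (apply holo_strip_minus; [apply holo_strip_mult; [exact hG|]|apply holo_strip_const]);
  [|apply hR].
apply holo_strip_plus; [apply holo_strip_const|exact hl].
Qed.

Lemma Cauchy_Gdd (c : C) (X : R) :
  admissible c -> 0 <= X ->
  exists V : C,
    @is_RInt C_R_NormedModule (fun x => Gdd c (x, PI) - Gdd c (x, (- PI)%R))%C (- X) X V /\
    @is_RInt C_R_NormedModule (fun y => Ci * (Gdd c (X, y) - Gdd c ((- X)%R, y)))%C (- PI) PI V.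
Proof.
intros hc hX; assert (hpi := PI_RGT_0).
assert (hi := proj1 hc); apply Rabs_lt_between in hi.
assert (m1 : - PI <= Rmin 0 (Im c)) by (apply Rmin_glb; lra).
assert (m2 : Rmax 0 (Im c) <= PI) by (apply Rmax_lub; lra).
assert (m3 := Rle_trans _ _ _ (Rmin_l 0 (Im c)) (Rmax_l 0 (Im c))).
generalize (Rmin_l 0 (Im c)) (Rmin_r 0 (Im c)) (Rmax_l 0 (Im c)) (Rmax_r 0 (Im c)); intros.
(* The two exceptional lines in increasing order; if Im c = 0 the middle strip is empty. *)
apply Cauchy_rect with (m := Rmin 0 (Im c)) (n := Rmax 0 (Im c)); try lra.
- intros z hz; apply cont2_Gdd; [exact hc|]; apply Rabs_le; lra.
- apply holo_Gdd; [exact hc|lra|lra|]; intros; lra.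
- apply holo_Gdd; [exact hc|lra|lra|]; intros y.
  unfold Rmin, Rmax; destruct Rle_dec; intros; lra.
- apply holo_Gdd; [exact hc|lra|lra|]; intros; lra.
Qed.

(** The Lagrange form of the divided difference. It agrees with [Gdd] because, with D(w) = 2L - w
    log w and G D = 2 - w, one has D(w0)(G(w) - G(w0)) = G(w)(w log w - w0 log w0) - (w - w0).
    Dividing by w - w0 gives the first quotient in [Gdd], and w0 = 1 gives the second. *)
Lemma Gdd_off (c z : C) :
  admissible c -> Rabs (Im z) <= PI -> z <> ln2 ->
  Cexp z <> Cexp c -> Cexp z <> 1 ->
  Gdd c z =
  (Cexp z * (G z / ((Cexp z - Cexp c) * (Cexp z - 1))
    - (2 - Cexp c) / (2 * ln2 - c * Cexp c) / ((Cexp z - Cexp c) * (Cexp c - 1))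
    + / (2 * ln2) / ((Cexp z - 1) * (Cexp c - 1))))%C.
Proof.
intros hc hz h2 hne h1; destruct (admissible_neq c hc) as (n1 & n2 & n3).
assert (zc : z <> c) by (now intros ->).
assert (z0 : z <> 0) by (intros ->; now apply h1, Cexp_0).
unfold Gdd; rewrite G_off by assumption.
rewrite !log_slope_off by (try rewrite Cexp_0; assumption).
rewrite Cexp_0.
assert (m1 := Cminus_eq_contra _ _ hne); assert (m2 := Cminus_eq_contra _ _ h1).
assert (m3 : (2 * ln2 - z * Cexp z)%C <> 0).
{ apply Cminus_eq_contra; intros e; now apply (z_Cexp_neq z hz). }
assert (m4 : RtoC ln2 <> 0) by (apply RtoC_neq_0; generalize ln2_pos; lra).
field; repeat split; try assumption; apply RtoC_neq_0; lra.
Qed.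

(** * Continuity of the density up to the endpoints *)

Lemma ln_nonpos (x : R) : x <= 0 -> ln x = 0.
Proof.
intros h; unfold ln; destruct (Rlt_dec 0 x); [exfalso; lra | reflexivity].
Qed.

(** Write ln t = 2 ln(sqrt t) and use ln y <= y at y = 1/sqrt t. *)
Lemma xlnx_bound (t : R) : 0 < t <= 1 -> Rabs (t * ln t) <= 2 * sqrt t.
Proof.
intros ht; assert (hs : 0 < sqrt t) by (apply sqrt_lt_R0; lra).
assert (hss : sqrt t * sqrt t = t) by (apply sqrt_sqrt; lra).
assert (h1 : ln t <= 0).
{ rewrite <- ln_1; destruct (Req_dec t 1) as [->|h]; [lra|].
  apply Rlt_le, ln_increasing; lra. }
assert (h2 : ln t = 2 * ln (sqrt t)).
{ rewrite <- hss at 1; rewrite ln_mult by exact hs; ring. }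
assert (h3 : - ln (sqrt t) <= / sqrt t).
{ rewrite <- ln_Rinv by exact hs.
  assert (hi : 0 < / sqrt t) by now apply Rinv_0_lt_compat.
  generalize (exp_ineq1_le (ln (/ sqrt t))); rewrite exp_ln by exact hi; lra. }
rewrite Rabs_left1 by nra.
apply Rle_trans with (t * (2 * / sqrt t)); [nra|].
rewrite <- hss at 1; right; field; lra.
Qed.

Lemma continuous_xlnx (t : R) : continuous (fun t => t * ln t) t.
Proof.
destruct (Rtotal_order t 0) as [h|[->|h]].
- apply (continuous_ext_loc (U := R_UniformSpace)) with (fun _ => 0);
    [|apply continuous_const].
  assert (hn : 0 < - t) by lra.
  exists (mkposreal _ hn); intros u hu; apply Rabs_lt_between' in hu; simpl in hu.
  rewrite ln_nonpos by lra; symmetry; apply Rmult_0_r.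
- apply continuity_pt_filterlim, continuity_pt_locally; intros eps.
  assert (hd : 0 < Rmin 1 ((eps / 2) ^ 2)).
  { apply Rmin_glb_lt; [lra|]; apply pow_lt, Rdiv_lt_0_compat; [apply cond_pos|lra]. }
  exists (mkposreal _ hd); intros u hu; apply Rabs_lt_between' in hu; cbn [pos] in hu.
  rewrite Rmult_0_l, Rminus_0_r.
  destruct (Rle_lt_dec u 0) as [hu0|hu0].
  + rewrite ln_nonpos, Rmult_0_r, Rabs_R0 by exact hu0; apply cond_pos.
  + generalize (Rmin_l 1 ((eps / 2) ^ 2)) (Rmin_r 1 ((eps / 2) ^ 2)); intros.
    assert (hu1 : 0 < u <= 1) by lra.
    apply Rle_lt_trans with (1 := xlnx_bound u hu1).
    assert (h : sqrt u < eps / 2); [|lra].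
    rewrite <- (sqrt_pow2 (eps / 2)) by (generalize (cond_pos eps); lra).
    apply sqrt_lt_1; [lra|apply pow2_ge_0|lra].
- apply (ex_derive_continuous (V := R_NormedModule)); auto_derive; exact h.
Qed.

(** Both [ln] on nonpositive reals and the inverse of 0 are 0, so the function vanishes on the left
    and at 0. On the right, u < exp(-1/eps) gives |1/ln u| < eps. *)
Lemma continuous_inv_ln_0 : continuous (fun s => / ln s) 0.
Proof.
apply continuity_pt_filterlim, continuity_pt_locally; intros eps.
exists (mkposreal _ (exp_pos (- / eps))); intros u hu.
apply Rabs_lt_between' in hu; simpl in hu.
rewrite (ln_nonpos 0), Rinv_0, Rminus_0_r by lra.
destruct (Rle_lt_dec u 0) as [h|h].
- rewrite ln_nonpos, Rinv_0, Rabs_R0 by exact h; apply cond_pos.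
- assert (hl : ln u < - / eps).
  { rewrite <- (ln_exp (- / eps)); apply ln_increasing; lra. }
  assert (he := Rinv_0_lt_compat _ (cond_pos eps)).
  rewrite Rabs_inv, Rabs_left by lra.
  rewrite <- (Rinv_inv eps); apply Rinv_lt_contravar; [|lra].
  apply Rmult_lt_0_compat; lra.
Qed.

(* [ln] is 0 on nonpositive reals, so [(1 - s) * ln (1 - s)] is continuous
   across [s = 1]; hence the logarithm is split. *)
Definition rho_ext (s : R) : R :=
  if Rle_dec s 0 then 0 else
  2 * ln2 * (1 - s ^ 2)
  / ((2 * ln2 * s + ((1 - s) * ln (1 - s) - (1 - s) * ln s)) ^ 2
     + PI ^ 2 * (1 - s) ^ 2).

Lemma rho_ext_eq (s : R) : 0 < s < 1 -> rho_ext s = rho s.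
Proof.
intros hs; unfold rho_ext, rho; destruct Rle_dec; [lra|].
rewrite ln_div by lra; do 4 f_equal; ring.
Qed.

Lemma rho_den_pos (p s : R) :
  s <> 1 -> 0 < p ^ 2 + PI ^ 2 * (1 - s) ^ 2.
Proof.
intros hs; assert (0 < PI ^ 2 * (1 - s) ^ 2); [|nra].
apply Rmult_lt_0_compat; [apply pow_lt, PI_RGT_0|].
replace ((1 - s) ^ 2) with (Rsqr (1 - s)) by (unfold Rsqr; ring).
apply Rlt_0_sqr; lra.
Qed.

Lemma rho_pos (s : R) : 0 < s < 1 -> 0 < rho s.
Proof.
intros hs; unfold rho; generalize ln2_pos; intros.
apply Rdiv_lt_0_compat; [|apply rho_den_pos; lra].
apply Rmult_lt_0_compat; nra.
Qed.

Lemma rho_ext_nonneg (s : R) : 0 <= s <= 1 -> 0 <= rho_ext s.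
Proof.
intros hs; destruct (Req_dec s 0) as [->|h0].
- unfold rho_ext; destruct Rle_dec; lra.
- destruct (Req_dec s 1) as [->|h1].
  + unfold rho_ext; destruct Rle_dec; [lra|]; unfold Rdiv.
    replace (1 - 1 ^ 2) with 0 by ring; lra.
  + rewrite rho_ext_eq by lra; apply Rlt_le, rho_pos; lra.
Qed.

Lemma continuous_Rdiv (f g : R -> R) (x : R) :
  continuous f x -> continuous g x -> g x <> 0 -> continuous (fun x => f x / g x) x.
Proof.
intros hf hg h; apply (continuous_mult (K := R_AbsRing)); [exact hf|].
now apply continuous_Rinv_comp.
Qed.

Lemma continuous_Rsqr_comp (f : R -> R) (x : R) :
  continuous f x -> continuous (fun x => f x ^ 2) x.
Proof.
intros hf; apply (continuous_ext (U := R_UniformSpace)) with (fun x => f x * f x).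
- intros y; simpl; rewrite Rmult_1_r; reflexivity.
- now apply (continuous_mult (K := R_AbsRing)).
Qed.

Ltac smooth := apply (ex_derive_continuous (V := R_NormedModule)); auto_derive; trivial.

Lemma continuous_rho_ext_pos (s : R) : 0 < s -> continuous rho_ext s.
Proof.
intros hs; apply (continuous_ext_loc (U := R_UniformSpace)) with (fun s =>
  2 * ln2 * (1 - s ^ 2)
  / ((2 * ln2 * s + ((1 - s) * ln (1 - s) - (1 - s) * ln s)) ^ 2
     + PI ^ 2 * (1 - s) ^ 2)).
{ exists (mkposreal _ hs); intros u hu; apply Rabs_lt_between' in hu; simpl in hu.
  unfold rho_ext; destruct Rle_dec; [lra|reflexivity]. }
apply continuous_Rdiv; [smooth| |].
- apply (continuous_plus (V := R_NormedModule)); [|smooth].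
  apply continuous_Rsqr_comp.
  apply (continuous_plus (V := R_NormedModule)); [smooth|].
  apply (continuous_minus (V := R_NormedModule)); [|smooth].
  apply (continuous_comp (fun s => 1 - s) (fun t => t * ln t)); [smooth|].
  apply continuous_xlnx.
- destruct (Req_dec s 1) as [->|h].
  (* At s = 1 the denominator is (2L)^2. *)
  + replace (1 - 1) with 0 by ring; generalize ln2_pos; intros; nra.
  + apply Rgt_not_eq, rho_den_pos, h.
Qed.

(** Multiplying numerator and denominator by (1/ln s)^2 removes the blow-up: the new denominator is
    1 at s = 0 and the numerator vanishes. For s <= 0 the convention 1/ln s = 0 makes both sides
    0. *)
Lemma continuous_rho_ext_0 : continuous rho_ext 0.
Proof.
apply (continuous_ext_loc (U := R_UniformSpace)) with (fun s =>
  2 * ln2 * (1 - s ^ 2) * (/ ln s) ^ 2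
  / ((2 * ln2 * s * / ln s + / ln s * ((1 - s) * ln (1 - s)) - (1 - s)) ^ 2
     + PI ^ 2 * (1 - s) ^ 2 * (/ ln s) ^ 2)).
{ exists (mkposreal _ Rlt_0_1); intros u hu; apply Rabs_lt_between' in hu; simpl in hu.
  unfold rho_ext; match goal with |- ?a = ?b => change (@eq R a b) end.
  destruct Rle_dec as [h|h].
  - rewrite (ln_nonpos u), Rinv_0 by exact h; unfold Rdiv; ring.
  - assert (hl : ln u < 0) by (rewrite <- ln_1; apply ln_increasing; lra).
    assert (h1 := rho_den_pos (2 * ln2 * u + ((1 - u) * ln (1 - u) - (1 - u) * ln u)) u
                    ltac:(lra)).
    assert (h2 := rho_den_pos (2 * ln2 * u + (1 - u) * ln (1 - u) - ln u * (1 - u)) u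
                    ltac:(lra)).
    field; repeat split; lra. }
apply continuous_Rdiv.
- apply (continuous_mult (K := R_AbsRing)); [smooth|].
  apply continuous_Rsqr_comp, continuous_inv_ln_0.
- apply (continuous_plus (V := R_NormedModule)).
  + apply continuous_Rsqr_comp, (continuous_minus (V := R_NormedModule)); [|smooth].
    apply (continuous_plus (V := R_NormedModule)); apply (continuous_mult (K := R_AbsRing));
      try apply continuous_inv_ln_0; [smooth|].
    apply (continuous_comp (fun s => 1 - s) (fun t => t * ln t)); [smooth|].
    apply continuous_xlnx.
  + apply (continuous_mult (K := R_AbsRing)); [smooth|].
    apply continuous_Rsqr_comp, continuous_inv_ln_0.
- rewrite (ln_nonpos 0), Rinv_0 by lra; lra.
Qed.

Lemma continuous_rho_ext (s : R) : 0 <= s -> continuous rho_ext s.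
Proof.
intros [h|<-]; [now apply continuous_rho_ext_pos | exact continuous_rho_ext_0].
Qed.

Lemma rho_ext_bounded : exists M, 0 < M /\ forall s, 0 <= s <= 1 -> 0 <= rho_ext s <= M.
Proof.
destruct (continuity_ab_maj rho_ext 0 1) as [x [hx _]]; [lra| |].
- intros s hs; apply continuity_pt_filterlim, continuous_rho_ext; lra.
- exists (Rabs (rho_ext x) + 1); split; [generalize (Rabs_pos (rho_ext x)); lra|].
  intros s hs; split; [now apply rho_ext_nonneg|].
  generalize (hx s hs) (Rle_abs (rho_ext x)); lra.
Qed.

(** * The Stieltjes kernel *)

Lemma norm_C_R (z : C) : @norm R_AbsRing C_R_NormedModule z = Cmod z.
Proof.
unfold norm, Cmod; simpl; unfold prod_norm; f_equal.
change (Rabs (fst z) ^ 2 + Rabs (snd z) ^ 2 = fst z ^ 2 + snd z ^ 2).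
now rewrite !pow2_abs.
Qed.

Lemma is_RInt_C_fst (f : R -> C) (a b : R) (l : C) :
  @is_RInt C_R_NormedModule f a b l -> is_RInt (fun t => Re (f t)) a b (Re l).
Proof.
exact (is_RInt_fct_extend_fst (U := R_NormedModule) (V := R_NormedModule) f a b l).
Qed.

Lemma is_RInt_C_snd (f : R -> C) (a b : R) (l : C) :
  @is_RInt C_R_NormedModule f a b l -> is_RInt (fun t => Im (f t)) a b (Im l).
Proof.
exact (is_RInt_fct_extend_snd (U := R_NormedModule) (V := R_NormedModule) f a b l).
Qed.

Lemma is_RInt_C_ext (f g : R -> C) (a b : R) (l : C) :
  a <= b -> (forall x, a < x < b -> f x = g x) ->
  @is_RInt C_R_NormedModule f a b l -> @is_RInt C_R_NormedModule g a b l.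
Proof.
intros hab h; apply (is_RInt_ext (V := C_R_NormedModule)).
now rewrite Rmin_left, Rmax_right by exact hab.
Qed.

Lemma is_RInt_Cmult (k : C) (f : R -> C) (a b : R) (l : C) :
  @is_RInt C_R_NormedModule f a b l ->
  @is_RInt C_R_NormedModule (fun x => k * f x)%C a b (k * l)%C.
Proof.
intros h; assert (h1 := is_RInt_C_fst _ _ _ _ h); assert (h2 := is_RInt_C_snd _ _ _ _ h).
apply is_RInt_C.
- exact (is_RInt_minus (V := R_NormedModule) _ _ _ _ _ _
    (is_RInt_scal (V := R_NormedModule) _ _ _ (Re k) _ h1)
    (is_RInt_scal (V := R_NormedModule) _ _ _ (Im k) _ h2)).
- exact (is_RInt_plus (V := R_NormedModule) _ _ _ _ _ _
    (is_RInt_scal (V := R_NormedModule) _ _ _ (Re k) _ h2)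
    (is_RInt_scal (V := R_NormedModule) _ _ _ (Im k) _ h1)).
Qed.

Lemma is_RInt_C_plus (f g : R -> C) (a b : R) (l m : C) :
  @is_RInt C_R_NormedModule f a b l -> @is_RInt C_R_NormedModule g a b m ->
  @is_RInt C_R_NormedModule (fun x => f x + g x)%C a b (l + m)%C.
Proof. exact (is_RInt_plus (V := C_R_NormedModule) f g a b l m). Qed.

Lemma is_RInt_C_minus (f g : R -> C) (a b : R) (l m : C) :
  @is_RInt C_R_NormedModule f a b l -> @is_RInt C_R_NormedModule g a b m ->
  @is_RInt C_R_NormedModule (fun x => f x - g x)%C a b (l - m)%C.
Proof. exact (is_RInt_minus (V := C_R_NormedModule) f g a b l m). Qed.

Lemma is_RInt_C_const (k : C) (a b : R) :
  @is_RInt C_R_NormedModule (fun _ => k) a b (RtoC (b - a) * k)%C.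
Proof.
rewrite <- scal_R_Cmult; exact (is_RInt_const (V := C_R_NormedModule) a b k).
Qed.

Lemma is_RInt_C_unique (f : R -> C) (a b : R) (l m : C) :
  @is_RInt C_R_NormedModule f a b l -> @is_RInt C_R_NormedModule f a b m -> l = m.
Proof.
intros h1 h2.
rewrite <- (is_RInt_unique (V := C_R_CompleteNormedModule) f a b l h1).
now apply (is_RInt_unique (V := C_R_CompleteNormedModule)).
Qed.

Lemma Cmod_RInt_le (f : R -> C) (a b M : R) (l : C) :
  a <= b -> (forall x, a <= x <= b -> Cmod (f x) <= M) ->
  @is_RInt C_R_NormedModule f a b l -> Cmod l <= (b - a) * M.
Proof.
intros hab hM h; rewrite <- norm_C_R.
apply (norm_RInt_le_const (V := C_R_NormedModule) f); [exact hab| |exact h].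
intros x hx; rewrite norm_C_R; now apply hM.
Qed.

Definition off_cut (z : C) : Prop := ~ (exists t : R, 1 <= t /\ z = RtoC t).

(** Built on [rho_ext] so that it is continuous, hence bounded, on the closed interval. *)
Definition kern (z : C) (s : R) : C := (RtoC (rho_ext s) / (1 - RtoC s * z))%C.

Lemma kern_den_neq_0 (z : C) (s : R) :
  off_cut z -> 0 <= s <= 1 -> (1 - RtoC s * z)%C <> 0.
Proof.
intros hz hs e; apply hz.
assert (hr := f_equal Re e); assert (hi := f_equal Im e).
destruct z as [x y]; unfold Re, Im in *; simpl in *.
assert (h0 : s <> 0) by (intros ->; lra).
exists (/ s); split.
- rewrite <- Rinv_1; apply Rinv_le_contravar; lra.
- apply injective_projections; simpl.
  + apply Rmult_eq_reg_l with s; [|exact h0]; rewrite Rinv_r by exact h0; lra.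
  + apply Rmult_eq_reg_l with s; [|exact h0]; lra.
Qed.

Lemma continuous_resolvent (z : C) (s : R) :
  (1 - RtoC s * z)%C <> 0 ->
  continuous (fun s => Re (/ (1 - RtoC s * z))) s /\
  continuous (fun s => Im (/ (1 - RtoC s * z))) s.
Proof.
intros h; apply Cneq_0_norm2 in h; destruct z as [x y]; unfold Re, Im in *; simpl in *.
split; smooth; split; trivial; contradict h; rewrite <- h; ring.
Qed.

Lemma continuous_kern (z : C) (s : R) :
  off_cut z -> 0 <= s <= 1 ->
  continuous (fun s => Re (kern z s)) s /\ continuous (fun s => Im (kern z s)) s.
Proof.
intros hz hs.
destruct (continuous_resolvent z s (kern_den_neq_0 z s hz hs)) as [h1 h2].
assert (hr := continuous_rho_ext s (proj1 hs)).
split.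
- apply (continuous_ext (U := R_UniformSpace)) with
    (fun s => rho_ext s * Re (/ (1 - RtoC s * z))).
  + intros t; symmetry; apply re_scal_l.
  + now apply (continuous_mult (K := R_AbsRing)).
- apply (continuous_ext (U := R_UniformSpace)) with
    (fun s => rho_ext s * Im (/ (1 - RtoC s * z))).
  + intros t; symmetry; apply im_scal_l.
  + now apply (continuous_mult (K := R_AbsRing)).
Qed.

Lemma is_RInt_kern (z : C) (a b : R) :
  off_cut z -> 0 <= a -> a <= b -> b <= 1 ->
  @is_RInt C_R_NormedModule (kern z) a b
    (RInt (fun s => Re (kern z s)) a b, RInt (fun s => Im (kern z s)) a b).
Proof.
intros hz ha hab hb; apply is_RInt_C; apply (RInt_correct (V := R_CompleteNormedModule)),
  (ex_RInt_continuous (V := R_CompleteNormedModule));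
  rewrite Rmin_left, Rmax_right by exact hab; intros s hs;
  destruct (continuous_kern z s hz ltac:(lra)); assumption.
Qed.

(** The inverse of x = log((1 - s)/s). It identifies the interval (0, 1) with the cut w = -exp x,
    reversing the orientation. *)
Definition logistic (x : R) : R := / (1 + exp x).

Lemma logistic_bounds (x : R) : 0 < logistic x < 1.
Proof.
unfold logistic; generalize (exp_pos x); intros; split.
- apply Rinv_0_lt_compat; lra.
- rewrite <- Rinv_1 at 2; apply Rinv_lt_contravar; lra.
Qed.

Lemma logistic_opp (x : R) : logistic (- x) = 1 - logistic x.
Proof.
unfold logistic; rewrite exp_Ropp; generalize (exp_pos x); intros; field; lra.
Qed.

Lemma logistic_le_exp (x : R) : logistic x <= exp (- x).
Proof.
unfold logistic; rewrite exp_Ropp; apply Rinv_le_contravar; [apply exp_pos|lra].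
Qed.

Lemma is_RInt_logistic (f : R -> R) (X : R) :
  (forall s, 0 < s < 1 -> continuous f s) ->
  is_RInt (fun x => exp x / (1 + exp x) ^ 2 * f (logistic x)) (- X) X
    (RInt f (logistic X) (logistic (- X))).
Proof.
intros hf.
(* The substitution is decreasing, so it is applied from X to -X; swapping the bounds then absorbs
   the minus sign of the derivative. *)
assert (h := is_RInt_comp (V := R_CompleteNormedModule) f logistic
  (fun x => - (exp x / (1 + exp x) ^ 2)) X (- X)).
assert (hp : forall x, 1 + exp x <> 0) by (intros x; generalize (exp_pos x); lra).
specialize (h (fun x _ => hf _ (logistic_bounds x))).
assert (h' : is_RInt (fun x => scal (- (exp x / (1 + exp x) ^ 2)) (f (logistic x))) X (- X)
               (RInt f (logistic X) (logistic (- X)))).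
{ apply h; intros x _; split.
  - unfold logistic; auto_derive; [apply hp|field; apply hp].
  - smooth; rewrite Rmult_1_r; apply Rmult_integral_contrapositive_currified; apply hp. }
apply (is_RInt_swap (V := R_NormedModule)) in h'.
apply (is_RInt_opp (V := R_NormedModule)) in h'.
rewrite opp_opp in h'.
revert h'; apply (is_RInt_ext (V := R_NormedModule)); intros x _.
unfold opp, scal; simpl; unfold mult; simpl; ring.
Qed.

Lemma is_RInt_kern_logistic (z : C) (X : R) (l : C) :
  off_cut z -> 0 <= X ->
  @is_RInt C_R_NormedModule (kern z) (logistic X) (logistic (- X)) l ->
  @is_RInt C_R_NormedModule
    (fun x => RtoC (exp x / (1 + exp x) ^ 2) * kern z (logistic x))%C (- X) X l.
Proof.
intros hz hX h; apply is_RInt_C.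
- apply (is_RInt_ext (V := R_NormedModule)) with
    (fun x => exp x / (1 + exp x) ^ 2 * Re (kern z (logistic x))).
  + intros x _; symmetry; apply re_scal_l.
  + apply is_RInt_C_fst in h; rewrite <- (is_RInt_unique _ _ _ _ h).
    apply (is_RInt_logistic (fun s => Re (kern z s))).
    intros s hs; destruct (continuous_kern z s hz ltac:(lra)); assumption.
- apply (is_RInt_ext (V := R_NormedModule)) with
    (fun x => exp x / (1 + exp x) ^ 2 * Im (kern z (logistic x))).
  + intros x _; symmetry; apply im_scal_l.
  + apply is_RInt_C_snd in h; rewrite <- (is_RInt_unique _ _ _ _ h).
    apply (is_RInt_logistic (fun s => Im (kern z s))).
    intros s hs; destruct (continuous_kern z s hz ltac:(lra)); assumption.
Qed.

(** * Boundary values on the strip *)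

Lemma Ci_Ci : (Ci * Ci)%C = RtoC (-1).
Proof. apply injective_projections; simpl; ring. Qed.

Lemma rho_logistic (x : R) :
  rho (logistic x) =
  2 * ln2 * exp x * (exp x + 2) / ((2 * ln2 + exp x * x) ^ 2 + PI ^ 2 * exp x ^ 2).
Proof.
assert (hu := exp_pos x); unfold rho.
replace ((1 - logistic x) / logistic x) with (exp x) by (unfold logistic; field; lra).
rewrite ln_exp; unfold logistic.
assert (h : 0 < PI ^ 2 * exp x ^ 2) by (apply Rmult_lt_0_compat; apply pow_lt; [apply PI_RGT_0|lra]).
assert (h' := pow2_ge_0 (2 * ln2 + exp x * x)).
field; split; [|lra].
rewrite Rpow_mult_distr; lra.
Qed.

Lemma Cexp_PI (x : R) : Cexp (x, PI) = RtoC (- exp x).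
Proof.
apply injective_projections; unfold Cexp, Re, Im; simpl; rewrite ?cos_PI, ?sin_PI; ring.
Qed.

Lemma Cexp_neg_PI (x : R) : Cexp (x, - PI) = RtoC (- exp x).
Proof.
apply injective_projections; unfold Cexp, Re, Im; simpl;
  rewrite ?cos_neg, ?sin_neg, ?cos_PI, ?sin_PI; ring.
Qed.

Lemma Cexp_neq_neg (c : C) (x : R) : admissible c -> Cexp c <> RtoC (- exp x).
Proof.
intros (h & _ & _) e; rewrite <- Cexp_PI in e; apply Rabs_lt_between in h.
apply Cexp_inj in e; [subst; simpl in h; lra|].
simpl; apply Rabs_lt_between; lra.
Qed.

(** With u = exp x, both boundary values have numerator 2 + u. Their denominators p and q are
    conjugate, with p q equal to the stated real number and q - p = -2 PI i u. *)
Lemma G_jump (x : R) :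
  (G (x, PI) - G (x, - PI)%R)%C =
  (- (2 * Ci * RtoC PI) * RtoC (exp x) * (RtoC (exp x) + 2)
   / RtoC ((2 * ln2 + exp x * x) ^ 2 + PI ^ 2 * exp x ^ 2))%C.
Proof.
assert (hu := exp_pos x); assert (hpi := PI_RGT_0).
assert (hN : 0 < (2 * ln2 + exp x * x) ^ 2 + PI ^ 2 * exp x ^ 2).
{ assert (h : 0 < PI ^ 2 * exp x ^ 2)
    by (apply Rmult_lt_0_compat; apply pow_lt; assumption).
  assert (h' := pow2_ge_0 (2 * ln2 + exp x * x)); lra. }
rewrite !G_off; try (intros e; apply (f_equal Im) in e; unfold Im in e; simpl in e; lra);
  try (simpl; apply Rabs_le; lra).
rewrite Cexp_PI, Cexp_neg_PI.
set (N := (2 * ln2 + exp x * x) ^ 2 + PI ^ 2 * exp x ^ 2) in *.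
set (p := (2 * ln2 - (x, PI) * RtoC (- exp x))%C).
set (q := (2 * ln2 - (x, (- PI)%R) * RtoC (- exp x))%C).
assert (hpq : RtoC N = (p * q)%C).
{ unfold N, p, q; apply injective_projections; simpl; ring. }
assert (hN0 : RtoC N <> 0) by (apply RtoC_neq_0; lra).
assert (hp : p <> 0) by (intros e; apply hN0; rewrite hpq, e; ring).
assert (hq : q <> 0) by (intros e; apply hN0; rewrite hpq, e; ring).
assert (hd : (q - p)%C = (- (2 * Ci * RtoC PI) * RtoC (exp x))%C).
{ unfold p, q; apply injective_projections; simpl; ring. }
rewrite hpq, <- hd, RtoC_opp; field; split; assumption.
Qed.

(** The exponential takes the same value on both edges, so in [Gdd_off] only the term with [G]
    survives the subtraction. The factor -(i L/PI) turns the -2 PI i of [G_jump] into the -2L which,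
    together with w = -u, yields the 2L of [rho]. *)
Lemma kern_jump (c : C) (x : R) :
  admissible c -> 
  (RtoC (exp x / (1 + exp x) ^ 2) * kern (1 - Cexp c) (logistic x))%C =
  (- (Ci * RtoC (ln2 / PI)) * (Gdd c (x, PI) - Gdd c (x, (- PI)%R)))%C.
Proof.
intros hc; assert (hu := exp_pos x); assert (hpi := PI_RGT_0).
assert (hne := Cexp_neq_neg c x hc).
assert (h1 : RtoC (- exp x) <> 1) by (intros e; apply (f_equal Re) in e; simpl in e; lra).
rewrite !Gdd_off; try exact hc;
  try (intros e; apply (f_equal Im) in e; unfold Im in e; simpl in e; lra);
  try (simpl; apply Rabs_le; lra);
  try (rewrite ?Cexp_PI, ?Cexp_neg_PI; congruence).
rewrite Cexp_PI, Cexp_neg_PI.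
transitivity (- (Ci * RtoC (ln2 / PI)) * RtoC (- exp x) * (G (x, PI) - G (x, - PI)%R)
   / ((RtoC (- exp x) - Cexp c) * (RtoC (- exp x) - 1)))%C.
2:{ destruct (admissible_neq c hc) as (n1 & n2 & n3); field; repeat split; try assumption;
    try (apply Cminus_eq_contra; congruence).
    apply RtoC_neq_0; generalize ln2_pos; lra. }
rewrite G_jump; unfold kern; rewrite rho_ext_eq by apply logistic_bounds; rewrite rho_logistic.
set (N := (2 * ln2 + exp x * x) ^ 2 + PI ^ 2 * exp x ^ 2).
assert (hN : 0 < N).
{ assert (h : 0 < PI ^ 2 * exp x ^ 2)
    by (apply Rmult_lt_0_compat; apply pow_lt; assumption).
  assert (h' := pow2_ge_0 (2 * ln2 + exp x * x)); unfold N; lra. }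
unfold logistic; set (u := exp x) in *.
rewrite RtoC_opp in *.
rewrite RtoC_inv, !RtoC_div, !RtoC_mult, !RtoC_plus by (try apply pow_nonzero; lra).
rewrite RtoC_pow, RtoC_plus.
assert (nu : (1 + RtoC u)%C <> 0) by (rewrite <- RtoC_plus; apply RtoC_neq_0; lra).
assert (nN : RtoC N <> 0) by (apply RtoC_neq_0; lra).
assert (nP : RtoC PI <> 0) by (apply RtoC_neq_0; lra).
assert (nw : (RtoC u + Cexp c)%C <> 0).
{ intros e; apply hne; transitivity ((RtoC u + Cexp c) - RtoC u)%C; [ring|]; rewrite e; ring. }
transitivity ((- (Ci * Ci)) * (2 * RtoC ln2 * RtoC u * RtoC u * (RtoC u + 2)
   / (RtoC N * (RtoC u + Cexp c) * (1 + RtoC u))))%C.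
- rewrite Ci_Ci; field; repeat split; assumption.
- field; repeat split; try assumption.
  + intros e; apply nu; transitivity (- (- RtoC u - 1))%C; [ring|]; rewrite e; ring.
  + intros e; apply nw; transitivity (- (- RtoC u - Cexp c))%C; [ring|]; rewrite e; ring.
Qed.

(** * Estimates on the vertical sides *)

Lemma Cmod_sub_ge (a b : C) : Cmod a - Cmod b <= Cmod (a - b).
Proof.
assert (h := Cmod_triangle (a - b) b); replace (a - b + b)%C with a in h by ring; lra.
Qed.

Lemma Cmod_inv_le (a : C) (r : R) : 0 < r -> r <= Cmod a -> Cmod (/ a) <= / r.
Proof.
intros hr h; rewrite Cmod_inv by (apply Cmod_gt_0; lra).
now apply Rinv_le_contravar.
Qed.

Lemma Cmod_triangle3 (a b c : C) : Cmod (a - b + c) <= Cmod a + Cmod b + Cmod c.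
Proof.
assert (h1 := Cmod_triangle (a - b) c); assert (h2 := Cmod_triangle a (- b)).
rewrite Cmod_opp in h2; unfold Cminus in *; lra.
Qed.

(** The identities w/(w - w0) = 1 + w0/(w - w0) and w/(w - 1) = 1 + 1/(w - 1) split off the limit
    -(a - b). Since |w - w0| and |w - 1| are at least |w|/2, every remaining term is O(1/|w|). *)
Lemma Gdd_far (w w0 g a b : C) :
  2 <= Cmod w -> 2 * Cmod w0 <= Cmod w -> Cmod g <= 2 ->
  Cmod (w * (g / ((w - w0) * (w - 1)) - a / (w - w0) + b / (w - 1)) + (a - b))
  <= (8 + 2 * Cmod a * Cmod w0 + 2 * Cmod b) / Cmod w.
Proof.
intros h1 h2 hg.
assert (k1 : Cmod w / 2 <= Cmod (w - w0)) by (generalize (Cmod_sub_ge w w0); lra).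
assert (k2 : Cmod w / 2 <= Cmod (w - 1)) by (generalize (Cmod_sub_ge w 1); rewrite Cmod_1; lra).
assert (n1 : (w - w0)%C <> 0) by (apply Cmod_gt_0; lra).
assert (n2 : (w - 1)%C <> 0) by (apply Cmod_gt_0; lra).
apply Cmod_inv_le in k1; [|lra]; apply Cmod_inv_le in k2; [|lra].
replace (w * (g / ((w - w0) * (w - 1)) - a / (w - w0) + b / (w - 1)) + (a - b))%C
  with (w * g * (/ (w - w0) * / (w - 1)) - a * w0 * / (w - w0) + b * / (w - 1))%C
  by (field; split; assumption).
apply Rle_trans with (1 := Cmod_triangle3 _ _ _).
rewrite !Cmod_mult.
set (r := Cmod w) in *.
replace (/ (r / 2)) with (2 / r) in * by (field; lra).
replace ((8 + 2 * Cmod a * Cmod w0 + 2 * Cmod b) / r) with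
  (r * 2 * (2 / r * (2 / r)) + Cmod a * Cmod w0 * (2 / r) + Cmod b * (2 / r))
  by (field; lra).
generalize (Cmod_ge_0 g) (Cmod_ge_0 a) (Cmod_ge_0 b) (Cmod_ge_0 w0)
  (Cmod_ge_0 (/ (w - w0))) (Cmod_ge_0 (/ (w - 1))); intros.
repeat apply Rplus_le_compat; repeat apply Rmult_le_compat; try lra;
  repeat apply Rmult_le_pos; lra.
Qed.

(** Near w = 0 the bracket is bounded, because |w - w0| >= |w0|/2 and |w - 1| >= 1/2; the decay is
    the outer factor w. *)
Lemma Gdd_near (w w0 g a b : C) (M : R) :
  0 < Cmod w0 -> Cmod w <= / 2 -> Cmod w <= Cmod w0 / 2 -> Cmod g <= M ->
  Cmod (w * (g / ((w - w0) * (w - 1)) - a / (w - w0) + b / (w - 1)))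
  <= (4 * M / Cmod w0 + 2 * Cmod a / Cmod w0 + 2 * Cmod b) * Cmod w.
Proof.
intros h0 h1 h2 hg.
assert (k1 : Cmod w0 / 2 <= Cmod (w - w0)).
{ generalize (Cmod_sub_ge w0 w); rewrite <- (Cmod_opp (w0 - w)), Copp_minus_distr; lra. }
assert (k2 : / 2 <= Cmod (w - 1)).
{ generalize (Cmod_sub_ge 1 w); rewrite <- (Cmod_opp (1 - w)), Copp_minus_distr, Cmod_1; lra. }
assert (n1 : (w - w0)%C <> 0) by (apply Cmod_gt_0; lra).
assert (n2 : (w - 1)%C <> 0) by (apply Cmod_gt_0; lra).
apply Cmod_inv_le in k1; [|lra]; apply Cmod_inv_le in k2; [|lra].
rewrite Cmod_mult, Rmult_comm; apply Rmult_le_compat_r; [apply Cmod_ge_0|].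
apply Rle_trans with (1 := Cmod_triangle3 _ _ _).
rewrite Rinv_inv in k2.
set (r := Cmod w0) in *.
replace (/ (r / 2)) with (2 / r) in * by (field; lra).
replace (4 * M / r + 2 * Cmod a / r + 2 * Cmod b) with
  (M * (2 / r * 2) + Cmod a * (2 / r) + Cmod b * 2) by (field; lra).
generalize (Cmod_ge_0 g) (Cmod_ge_0 a) (Cmod_ge_0 b)
  (Cmod_ge_0 (/ (w - w0))) (Cmod_ge_0 (/ (w - 1))); intros.
replace (g / ((w - w0) * (w - 1)))%C with (g * (/ (w - w0) * / (w - 1)))%C
  by (field; split; assumption).
unfold Cdiv; rewrite !Cmod_mult.
repeat apply Rplus_le_compat; repeat apply Rmult_le_compat; try lra;
  repeat apply Rmult_le_pos; lra.
Qed.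

Lemma exp_quadratic (X : R) : 0 <= X -> (1 + X / 2) ^ 2 <= exp X.
Proof.
intros h; replace X with (X / 2 + X / 2) at 2 by field; rewrite exp_plus.
generalize (exp_ineq1_le (X / 2)); intros; nra.
Qed.

Lemma Cmod_div_le (a b : C) (p q : R) :
  0 < q -> Cmod a <= p -> q <= Cmod b -> Cmod (a / b) <= p / q.
Proof.
intros hq ha hb; unfold Cdiv; rewrite Cmod_mult.
apply Rmult_le_compat; try apply Cmod_ge_0; [exact ha|now apply Cmod_inv_le].
Qed.

(** Here |w log w| >= 16 |w| dominates 2L, so the denominator is at least |w| while the numerator is
    at most 2 |w|. *)
Lemma G_far (z : C) :
  Rabs (Im z) <= PI -> 16 <= Re z -> Cmod (G z) <= 2.
Proof.
intros hi hr.
assert (hw := Cmod_Cexp z).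
assert (he : 2 <= exp (Re z)) by (generalize (exp_ineq1_le (Re z)); lra).
assert (hl := ln_lt_2); fold ln2 in hl.
assert (hl1 : ln2 <= 1).
{ unfold ln2; generalize (exp_ineq1_le (ln 2)); rewrite exp_ln; lra. }
rewrite G_off; [|exact hi|intros ->; simpl in hr; lra].
replace 2 with (2 * Cmod (Cexp z) / Cmod (Cexp z)) at 3 by (field; lra).
apply Cmod_div_le; [lra| |].
- generalize (Cmod_triangle 2 (- Cexp z)); rewrite Cmod_opp, Cmod_R, Rabs_pos_eq by lra.
  unfold Cminus; lra.
- rewrite <- (Cmod_opp (_ - _)), Copp_minus_distr.
  assert (h := Cmod_sub_ge (z * Cexp z) (2 * ln2)).
  rewrite !Cmod_mult, !Cmod_R, !Rabs_pos_eq in h by lra.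
  assert (hz := re_le_Cmod z); rewrite Rabs_pos_eq in hz by lra.
  assert (16 * Cmod (Cexp z) <= Cmod z * Cmod (Cexp z))
    by (apply Rmult_le_compat_r; [apply Cmod_ge_0|lra]).
  lra.
Qed.

(** The quadratic lower bound for exp makes |w log w| <= 1/2. As L > 1/2, the denominator is then at
    least 1/2; the numerator is at most 3. *)
Lemma G_near (z : C) :
  Rabs (Im z) <= PI -> Re z <= - 16 -> Cmod (G z) <= 6.
Proof.
intros hi hr.
assert (hw := Cmod_Cexp z).
assert (hp := exp_pos (Re z)).
assert (he : (1 - Re z / 2) ^ 2 * exp (Re z) <= 1).
{ replace 1 with (exp (- Re z) * exp (Re z)) at 2
    by (rewrite <- exp_plus, Rplus_opp_l; apply exp_0).
  apply Rmult_le_compat_r; [lra|].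
  generalize (exp_quadratic (- Re z)); intros h; specialize (h ltac:(lra)).
  replace (1 - Re z / 2) with (1 + - Re z / 2) by field; exact h. }
assert (hl := ln_lt_2); fold ln2 in hl.
rewrite G_off; [|exact hi|intros ->; simpl in hr; lra].
replace 6 with (3 / / 2) by field.
assert (hz : Cmod z * Cmod (Cexp z) <= / 2).
{ assert (h1 := Cmod_le_Rabs z); rewrite (Rabs_left (Re z)) in h1 by lra.
  assert (h2 := PI_4); rewrite hw.
  apply Rle_trans with ((4 - Re z) * exp (Re z)); [apply Rmult_le_compat_r; lra|].
  nra. }
apply Cmod_div_le; [lra| |].
- generalize (Cmod_triangle 2 (- Cexp z)); rewrite Cmod_opp, Cmod_R, Rabs_pos_eq by lra.
  assert (exp (Re z) <= 1) by (rewrite <- exp_0; apply Rlt_le, exp_increasing; lra).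
  unfold Cminus; lra.
- assert (h := Cmod_sub_ge (2 * ln2) (z * Cexp z)).
  rewrite !Cmod_mult, !Cmod_R, !Rabs_pos_eq in h by lra; lra.
Qed.

(** The first divided difference G[w0, 1], where G(1) = 1/(2L). *)
Definition Gdd_limit (c : C) : C :=
  (((2 - Cexp c) / (2 * ln2 - c * Cexp c) - / (2 * ln2)) / (Cexp c - 1))%C.

Lemma Gdd_ends (c : C) :
  admissible c ->
  exists K X0, 0 <= X0 /\ 0 <= K /\ forall X y, X0 <= X -> Rabs y <= PI ->
    Cmod (Gdd c (X, y) - Gdd c ((- X)%R, y) + Gdd_limit c) <= K * exp (- X).
Proof.
intros hc; destruct (admissible_neq c hc) as (n1 & n2 & n3).
set (w0 := Cexp c).
assert (h0 : 0 < Cmod w0) by (apply Cmod_gt_0, Cexp_neq_0).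
set (a := ((2 - w0) / (2 * ln2 - c * w0) / (w0 - 1))%C).
set (b := (/ (2 * ln2) / (w0 - 1))%C).
assert (hD : Gdd_limit c = (a - b)%C)
  by (unfold Gdd_limit, a, b, w0; field; repeat split; try assumption;
      apply RtoC_neq_0; generalize ln2_pos; lra).
set (K1 := 8 + 2 * Cmod a * Cmod w0 + 2 * Cmod b).
set (K2 := 4 * 6 / Cmod w0 + 2 * Cmod a / Cmod w0 + 2 * Cmod b).
assert (pa := Cmod_ge_0 a); assert (pb := Cmod_ge_0 b).
assert (pi0 := Rinv_0_lt_compat _ h0).
(* Since exp X >= 1 + X, the three summands of the threshold serve [G_far] and [G_near], then
   [Gdd_far], then [Gdd_near]. *)
exists (K1 + K2), (16 + 2 * Cmod w0 + 2 / Cmod w0).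
split; [unfold Rdiv; lra|split].
{ unfold K1, K2, Rdiv.
  assert (0 <= Cmod a * Cmod w0) by (apply Rmult_le_pos; lra).
  assert (0 <= Cmod a * / Cmod w0) by (apply Rmult_le_pos; lra).
  lra. }
intros X y hX hy.
assert (hX1 : 16 <= X) by (unfold Rdiv in hX; lra).
assert (he := exp_ineq1_le X).
assert (hw : Cmod (Cexp (X, y)) = exp X) by apply Cmod_Cexp.
assert (hw' : Cmod (Cexp ((- X)%R, y)) = exp (- X)) by apply Cmod_Cexp.
assert (hi : 2 / Cmod w0 <= exp X) by (unfold Rdiv in *; lra).
assert (hi' : exp (- X) <= Cmod w0 / 2).
{ rewrite exp_Ropp; replace (Cmod w0 / 2) with (/ (2 / Cmod w0)) by (field; lra).
  apply Rinv_le_contravar; [unfold Rdiv; lra|exact hi]. }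
assert (hh : exp (- X) <= / 2) by (rewrite exp_Ropp; apply Rinv_le_contravar; lra).
assert (hi0 : 2 * Cmod w0 <= exp X) by (unfold Rdiv in hX; lra).
assert (neq : forall u v : C, Cmod u <> Cmod v -> u <> v) by (intros u v h e; now rewrite e in h).
assert (t1 := Gdd_far (Cexp (X, y)) w0 (G (X, y)) a b ltac:(lra) ltac:(lra)
                (G_far (X, y) hy hX1)).
assert (t2 := Gdd_near (Cexp ((- X)%R, y)) w0 (G ((- X)%R, y)) a b 6 h0 ltac:(lra) ltac:(lra)
                (G_near ((- X)%R, y) hy ltac:(simpl; lra))).
rewrite hw in t1; rewrite hw' in t2; fold K1 in t1; fold K2 in t2.
assert (hL := ln2_pos).
assert (e1 : Gdd c (X, y) = (Cexp (X, y) * (G (X, y) / ((Cexp (X, y) - w0) * (Cexp (X, y) - 1))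
  - a / (Cexp (X, y) - w0) + b / (Cexp (X, y) - 1)))%C).
{ assert (q1 : Cexp (X, y) <> w0) by (apply neq; rewrite hw; unfold Rdiv in hi; lra).
  assert (q2 : Cexp (X, y) <> 1) by (apply neq; rewrite hw, Cmod_1; lra).
  rewrite Gdd_off; [|exact hc|exact hy| |exact q1|exact q2].
  - fold w0; unfold a, b; field; repeat split; try assumption;
      try (now apply Cminus_eq_contra); apply RtoC_neq_0; lra.
  - intros e; apply (f_equal Re) in e; simpl in e.
    assert (ln2 <= 1) by (unfold ln2; generalize (exp_ineq1_le (ln 2)); rewrite exp_ln; lra).
    lra. }
assert (e2 : Gdd c ((- X)%R, y) = (Cexp ((- X)%R, y) *
  (G ((- X)%R, y) / ((Cexp ((- X)%R, y) - w0) * (Cexp ((- X)%R, y) - 1))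
  - a / (Cexp ((- X)%R, y) - w0) + b / (Cexp ((- X)%R, y) - 1)))%C).
{ assert (q1 : Cexp ((- X)%R, y) <> w0) by (apply neq; rewrite hw'; lra).
  assert (q2 : Cexp ((- X)%R, y) <> 1) by (apply neq; rewrite hw', Cmod_1; lra).
  rewrite Gdd_off; [|exact hc|exact hy| |exact q1|exact q2].
  - fold w0; unfold a, b; field; repeat split; try assumption;
      try (now apply Cminus_eq_contra); apply RtoC_neq_0; lra.
  - intros e; apply (f_equal Re) in e; simpl in e; lra. }
rewrite <- e1 in t1; rewrite <- e2 in t2; rewrite hD.
replace (Gdd c (X, y) - Gdd c ((- X)%R, y) + (a - b))%C
  with ((Gdd c (X, y) + (a - b)) + - Gdd c ((- X)%R, y))%C by ring.
apply Rle_trans with (1 := Cmod_triangle _ _); rewrite Cmod_opp.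
rewrite Rmult_plus_distr_r; apply Rplus_le_compat; [|exact t2].
rewrite exp_Ropp; exact t1.
Qed.

Lemma is_RInt_kern_admissible (c : C) :
  admissible c -> off_cut (1 - Cexp c) ->
  @is_RInt C_R_NormedModule (kern (1 - Cexp c)) 0 1 (- (2 * ln2) * Gdd_limit c)%C.
Proof.
intros hc hz; set (z := (1 - Cexp c)%C) in *.
assert (hpi := PI_RGT_0).
assert (hJ := is_RInt_kern z 0 1 hz (Rle_refl 0) Rle_0_1 (Rle_refl 1)).
set (J := (_, _)) in hJ.
enough (e : J = (- (2 * ln2) * Gdd_limit c)%C) by now rewrite <- e.
destruct (Gdd_ends c hc) as (K & X0 & hX0 & hK & hends).
assert (hB : exists B, 0 <= B /\ forall s, 0 <= s <= 1 -> Cmod (kern z s) <= B).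
{ destruct (continuity_ab_maj (fun s => Rabs (Re (kern z s))) 0 1) as [p [hp _]]; [lra| |].
  { intros s hs; apply continuity_pt_filterlim.
    apply (continuous_comp (fun s => Re (kern z s)) Rabs); [|apply continuous_Rabs].
    destruct (continuous_kern z s hz hs); assumption. }
  destruct (continuity_ab_maj (fun s => Rabs (Im (kern z s))) 0 1) as [q [hq _]]; [lra| |].
  { intros s hs; apply continuity_pt_filterlim.
    apply (continuous_comp (fun s => Im (kern z s)) Rabs); [|apply continuous_Rabs].
    destruct (continuous_kern z s hz hs); assumption. }
  exists (Rabs (Re (kern z p)) + Rabs (Im (kern z q))); split.
  - generalize (Rabs_pos (Re (kern z p))) (Rabs_pos (Im (kern z q))); lra.
  - intros s hs; apply Rle_trans with (1 := Cmod_le_Rabs _).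
    specialize (hp s hs); specialize (hq s hs); lra. }
destruct hB as (B & hB0 & hB).
(* The interval is split at [logistic X] and [logistic (- X)]. The two end pieces have length at
   most exp(-X) and a bounded integrand; the middle piece is the jump integral of Cauchy's
   theorem. *)
assert (est : forall X, X0 <= X ->
  Cmod (J - - (2 * ln2) * Gdd_limit c) <= (2 * B + ln2 * 2 * K) * exp (- X)).
{ intros X hX; assert (hX' : 0 <= X) by lra.
  assert (s1 := logistic_bounds X); assert (s2 := logistic_opp X).
  assert (s3 := logistic_le_exp X).
  assert (s4 : logistic X <= / 2).
  { unfold logistic; apply Rinv_le_contravar; [lra|].
    generalize (exp_ineq1_le X); lra. }
  assert (hm := is_RInt_kern z (logistic X) (logistic (- X)) hz
     ltac:(lra) ltac:(lra) ltac:(lra)).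
  set (JX := (_, _)) in hm.
  assert (h1 := is_RInt_kern z 0 (logistic X) hz ltac:(lra) ltac:(lra) ltac:(lra)).
  set (J1 := (_, _)) in h1.
  assert (h2 := is_RInt_kern z (logistic (- X)) 1 hz ltac:(lra) ltac:(lra) ltac:(lra)).
  set (J2 := (_, _)) in h2.
  assert (eJ : J = (J1 + JX + J2)%C).
  { apply (is_RInt_C_unique (kern z) 0 1); [exact hJ|].
    exact (is_RInt_Chasles (V := C_R_NormedModule) _ _ _ _ _ _
      (is_RInt_Chasles (V := C_R_NormedModule) _ _ _ _ _ _ h1 hm) h2). }
  assert (b1 : Cmod J1 <= (logistic X - 0) * B).
  { apply (Cmod_RInt_le (kern z)); [lra| |exact h1]; intros s hs; apply hB; lra. }
  assert (b2 : Cmod J2 <= (1 - logistic (- X)) * B).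
  { apply (Cmod_RInt_le (kern z)); [lra| |exact h2]; intros s hs; apply hB; lra. }
  destruct (Cauchy_Gdd c X hc hX') as (V & hV1 & hV2).
  assert (eX : JX = (- (Ci * RtoC (ln2 / PI)) * V)%C).
  { apply (is_RInt_C_unique _ _ _ _ _ (is_RInt_kern_logistic z X JX hz hX' hm)).
    apply (is_RInt_C_ext (fun x => - (Ci * RtoC (ln2 / PI)) *
      (Gdd c (x, PI) - Gdd c (x, (- PI)%R)))%C); [lra| |now apply is_RInt_Cmult].
    intros x _; symmetry; now apply kern_jump. }
  (* Adding the limit over the height 2 PI leaves W = V + 2 PI i G[w0, 1], which is O(exp(-X)).
     Replacing V by -2 PI i G[w0, 1] in -(i L/PI) V produces the claimed value -2L G[w0, 1]. *)
  assert (hV3 := is_RInt_C_plus _ _ _ _ _ _ hV2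
                   (is_RInt_C_const (Ci * Gdd_limit c)%C (- PI) PI)).
  apply (Cmod_RInt_le _ _ _ (K * exp (- X))) in hV3; [|lra|].
  2:{ intros y hy.
    replace (Ci * (Gdd c (X, y) - Gdd c ((- X)%R, y)) + Ci * Gdd_limit c)%C
      with (Ci * (Gdd c (X, y) - Gdd c ((- X)%R, y) + Gdd_limit c))%C by ring.
    rewrite Cmod_mult, Cmod_Ci, Rmult_1_l; apply hends; [exact hX|]; apply Rabs_le; lra. }
  set (W := (V + RtoC (PI - - PI) * (Ci * Gdd_limit c))%C) in *.
  assert (eW : (J - - (2 * ln2) * Gdd_limit c)%C =
    (J1 + J2 + - (Ci * RtoC (ln2 / PI)) * W)%C).
  { rewrite eJ, eX; unfold W; rewrite RtoC_div by lra.
    replace (PI - - PI) with (2 * PI) by ring; rewrite RtoC_mult.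
    transitivity (J1 + J2 + - (Ci * (ln2 / PI)) * V - (Ci * Ci) * (2 * ln2) * Gdd_limit c)%C;
      [rewrite Ci_Ci; ring|].
    field; apply RtoC_neq_0; lra. }
  rewrite eW; apply Rle_trans with (1 := Cmod_triangle _ _).
  assert (hJ12 := Cmod_triangle J1 J2).
  rewrite Cmod_mult, Cmod_opp, Cmod_mult, Cmod_Ci, Cmod_R.
  assert (hL := ln2_pos).
  rewrite Rabs_pos_eq by (apply Rlt_le, Rdiv_lt_0_compat; lra).
  assert (hW : 1 * (ln2 / PI) * Cmod W <= ln2 * 2 * K * exp (- X)).
  { replace (ln2 * 2 * K * exp (- X)) with (1 * (ln2 / PI) * ((PI - - PI) * (K * exp (- X))))
      by (field; lra).
    apply Rmult_le_compat_l; [|exact hV3].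
    rewrite Rmult_1_l; apply Rlt_le, Rdiv_lt_0_compat; lra. }
  assert (logistic X * B <= exp (- X) * B) by (apply Rmult_le_compat_r; assumption).
  rewrite s2 in b2.
  lra. }
assert (hQ : 0 <= 2 * B + ln2 * 2 * K).
{ assert (0 <= ln2 * K) by (apply Rmult_le_pos; [apply Rlt_le, ln2_pos|exact hK]); lra. }
apply Ceq_minus, Cmod_eq_0, Rle_antisym; [|apply Cmod_ge_0].
apply le_epsilon; intros eps heps; rewrite Rplus_0_l.
set (Q := 2 * B + ln2 * 2 * K) in *.
(* With exp X >= 1 + X >= Q/eps, the bound Q exp(-X) is at most eps. *)
set (X := X0 + Q / eps).
assert (hq : 0 <= Q / eps) by (apply Rdiv_le_0_compat; lra).
apply Rle_trans with (1 := est X ltac:(unfold X; lra)).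
rewrite exp_Ropp.
apply Rle_div_l; [apply Rlt_gt, exp_pos|].
assert (h := exp_ineq1_le X).
apply Rle_trans with (eps * (Q / eps)); [right; field; lra|].
apply Rmult_le_compat_l; unfold X in *; lra.
Qed.

(** * The representation and its consequences *)

Lemma Cexp_Clog (w : C) : w <> 0 -> Cexp (Clog w) = w.
Proof.
intros hw; destruct (Clog_principal w hw) as (h1 & h2 & _).
now apply injective_projections.
Qed.

Lemma admissible_Clog (z : C) :
  off_cut z -> z <> 0 -> z <> -1 -> admissible (Clog (1 - z)) /\ Cexp (Clog (1 - z)) = (1 - z)%C.
Proof.
intros hz h0 h1.
assert (hw : (1 - z)%C <> 0).
{ apply Cminus_eq_contra; intros e; apply hz; exists 1; split; [lra|now symmetry]. }
assert (he := Cexp_Clog _ hw).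
split; [split; [|split]|exact he].
- destruct (Clog_principal _ hw) as (k1 & k2 & k3 & [k4|k4]).
  + now apply Rabs_lt_between.
  (* Argument exactly PI means 1 - z = -r with r > 0, so z = 1 + r lies on the cut. *)
  + exfalso; apply hz; rewrite k4, cos_PI in k1; rewrite k4, sin_PI in k2.
    set (r := exp (Re (Clog (1 - z)))) in *; assert (0 < r) by apply exp_pos.
    exists (1 + r); split; [lra|].
    destruct z as [x y]; unfold Re, Im in k1, k2; simpl in k1, k2.
    apply injective_projections; simpl; lra.
- intros e; rewrite e, Cexp_0 in he; apply h0.
  transitivity (1 - (1 - z))%C; [ring|]; rewrite <- he; ring.
- intros e; rewrite e, Cexp_ln2 in he; apply h1.
  transitivity (1 - (1 - z))%C; [ring|]; rewrite <- he; ring.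
Qed.

Lemma is_RInt_kern_generic (z : C) :
  off_cut z -> z <> 0 -> z <> -1 ->
  @is_RInt C_R_NormedModule (kern z) 0 1
    ((2 * ln2 * z + (1 - z) * Clog (1 - z)) / (z * (2 * ln2 - (1 - z) * Clog (1 - z))))%C.
Proof.
intros hz h0 h1; destruct (admissible_Clog z hz h0 h1) as [hc he].
assert (h := is_RInt_kern_admissible _ hc); rewrite he in h.
destruct (admissible_neq _ hc) as (n1 & n2 & n3).
unfold Gdd_limit in h; rewrite he in *.
set (c := Clog (1 - z)) in *.
replace (1 - (1 - z))%C with z in h by ring.
replace ((2 * ln2 * z + (1 - z) * c) / (z * (2 * ln2 - (1 - z) * c)))%C
  with (- (2 * ln2) * (((2 - (1 - z)) / (2 * ln2 - c * (1 - z)) - / (2 * ln2)) / (1 - z - 1)))%C;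
  [now apply h|].
field; repeat split; try assumption.
- intros e; apply n1; rewrite <- e; ring.
- apply RtoC_neq_0; generalize ln2_pos; lra.
Qed.

(** * The removable points 0 and -1, approached along the real axis *)

Lemma Clog_pos (x : R) : 0 < x -> Clog x = RtoC (ln x).
Proof.
intros h; unfold Clog, Carg; rewrite Cmod_R, Rabs_pos_eq by lra.
simpl; replace (x / x) with 1 by (field; lra).
rewrite acos_1, Ropp_0; destruct Rle_dec; reflexivity.
Qed.

Definition g_num (t : R) : R := 2 * ln2 * t + (1 - t) * ln (1 - t).
Definition g_den (t : R) : R := t * (2 * ln2 - (1 - t) * ln (1 - t)).

Lemma is_RInt_kern_real (t : R) :
  t < 1 -> t <> 0 -> t <> -1 ->
  @is_RInt C_R_NormedModule (kern t) 0 1 (RtoC (g_num t) / RtoC (g_den t))%C.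
Proof.
intros h h0 h1.
replace (RtoC (g_num t) / RtoC (g_den t))%C with
  ((2 * ln2 * t + (1 - t) * Clog (1 - t)) / (t * (2 * ln2 - (1 - t) * Clog (1 - t))))%C.
- apply is_RInt_kern_generic.
  + intros (u & hu & e); apply (f_equal Re) in e; simpl in e; lra.
  + intros e; apply (f_equal Re) in e; simpl in e; lra.
  + intros e; apply (f_equal Re) in e; simpl in e; lra.
- rewrite <- RtoC_minus, Clog_pos by lra.
  unfold g_num, g_den.
  now rewrite RtoC_plus, !RtoC_mult, !RtoC_minus, !RtoC_mult, !RtoC_minus.
Qed.

(** For t <= 0 and h <= 1/2 the two denominators are at least 1 and 1/2, and their difference is s
    h. *)
Lemma kern_lipschitz (t h s M : R) :
  t <= 0 -> 0 < h <= / 2 -> 0 <= s <= 1 -> 0 <= rho_ext s <= M ->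
  Cmod (kern t s - kern (t + h)%R s) <= 2 * M * h.
Proof.
intros ht hh hs hM.
assert (d1 : 1 <= 1 - s * t) by nra.
assert (d2 : / 2 <= 1 - s * (t + h)) by nra.
unfold kern; rewrite <- !RtoC_mult, <- !RtoC_minus, <- !RtoC_div, <- RtoC_minus, Cmod_R by lra.
replace (rho_ext s / (1 - s * t) - rho_ext s / (1 - s * (t + h)))
  with (- (rho_ext s * (s * h) * (/ (1 - s * t) * / (1 - s * (t + h)))))
  by (field; lra).
assert (i1 : 0 < / (1 - s * t) <= 1).
{ split; [apply Rinv_0_lt_compat; lra|]; rewrite <- Rinv_1; apply Rinv_le_contravar; lra. }
assert (i2 : 0 < / (1 - s * (t + h)) <= 2).
{ split; [apply Rinv_0_lt_compat; lra|].
  rewrite <- (Rinv_inv 2); apply Rinv_le_contravar; lra. }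
rewrite Rabs_Ropp, Rabs_pos_eq by (repeat apply Rmult_le_pos; lra).
replace (2 * M * h) with (M * (1 * h) * (1 * 2)) by ring.
repeat apply Rmult_le_compat; try lra; repeat apply Rmult_le_pos; lra.
Qed.

(** The shift by 2 keeps steps at most 1/2, as [kern_lipschitz] requires; it also keeps -1 +
    [step n] below 0 and 0 + [step n] below 1. *)
Definition step (n : nat) : R := / (INR n + 2).

Lemma step_bounds (n : nat) : 0 < step n <= / 2.
Proof.
unfold step; generalize (pos_INR n); intros; split.
- apply Rinv_0_lt_compat; lra.
- apply Rinv_le_contravar; lra.
Qed.

Lemma is_lim_step : is_lim_seq step 0.
Proof.
apply (is_lim_seq_inv _ p_infty); [|discriminate].
apply is_lim_seq_plus with p_infty 2; [apply is_lim_seq_INR|apply is_lim_seq_const|reflexivity].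
Qed.

Lemma is_lim_derive_step (f : R -> R) (x l : R) :
  is_derive f x l -> f x = 0 -> is_lim_seq (fun n => f (x + step n) / step n) l.
Proof.
intros h h0; apply is_derive_Reals in h.
apply is_lim_seq_spec; intros eps; destruct (h eps (cond_pos eps)) as [d hd].
assert (hs := is_lim_step); apply is_lim_seq_spec in hs; destruct (hs d) as [N hN].
exists N; intros n hn; specialize (hN n hn); rewrite Rminus_0_r in hN.
specialize (hd (step n) (Rgt_not_eq _ _ (proj1 (step_bounds n))) hN).
now rewrite h0, Rminus_0_r in hd.
Qed.

(* The integral depends continuously on [z]; l'Hopital gives the limit of the
   closed form. *)
Lemma is_RInt_kern_removable (t N' D' : R) :
  -1 <= t <= 0 -> (forall n, t + step n <> 0 /\ t + step n <> -1) ->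
  g_num t = 0 -> g_den t = 0 -> is_derive g_num t N' -> is_derive g_den t D' -> D' <> 0 ->
  (forall n, g_den (t + step n) <> 0) ->
  @is_RInt C_R_NormedModule (kern t) 0 1 (RtoC (N' / D')).
Proof.
intros ht hne hN0 hD0 hN hD hD' hnz.
assert (hz : off_cut t).
{ intros (u & hu & e); apply (f_equal Re) in e; simpl in e; lra. }
assert (hJ := is_RInt_kern t 0 1 hz (Rle_refl 0) Rle_0_1 (Rle_refl 1)).
set (J := (_, _)) in hJ.
enough (e : J = RtoC (N' / D')) by now rewrite <- e.
destruct rho_ext_bounded as (M & hM0 & hM).
set (q := fun n => g_num (t + step n) / g_den (t + step n)).
assert (lq : is_lim_seq q (N' / D')).
{ apply is_lim_seq_ext with
    (fun n => (g_num (t + step n) / step n) / (g_den (t + step n) / step n)).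
  - intros n; unfold q; field; split; [apply hnz|].
    generalize (step_bounds n); lra.
  - apply (is_lim_seq_div _ _ N' D'); [now apply is_lim_derive_step..| |reflexivity].
    intros e; apply hD'; now inversion e. }
assert (est : forall n, Cmod (J - RtoC (N' / D')) <= 2 * M * step n + Rabs (q n - N' / D')).
{ intros n; assert (hs := step_bounds n); destruct (hne n) as [ne1 ne2].
  assert (h1 := is_RInt_kern_real (t + step n) ltac:(lra) ne1 ne2).
  rewrite <- RtoC_div in h1 by apply hnz; fold (q n) in h1.
  assert (h2 := is_RInt_C_minus _ _ _ _ _ _ hJ h1).
  apply (Cmod_RInt_le _ _ _ (2 * M * step n)) in h2; [|lra|].
  2:{ intros s hs'; apply kern_lipschitz; [lra|lra|exact hs'|now apply hM]. }
  replace (J - RtoC (N' / D'))%C with ((J - RtoC (q n)) + RtoC (q n - N' / D'))%C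
    by (rewrite RtoC_minus; ring).
  apply Rle_trans with (1 := Cmod_triangle _ _); rewrite Cmod_R; lra. }
apply Ceq_minus, Cmod_eq_0, Rle_antisym; [|apply Cmod_ge_0].
assert (lim : is_lim_seq (fun n => 2 * M * step n + Rabs (q n - N' / D')) 0).
{ replace (Finite 0) with (Finite (2 * M * 0 + Rabs (N' / D' - N' / D')))
    by (f_equal; rewrite Rminus_diag, Rabs_R0; ring).
  apply is_lim_seq_plus'.
  - apply (is_lim_seq_scal_l _ (2 * M) 0), is_lim_step.
  - apply (is_lim_seq_abs _ (N' / D' - N' / D')).
    apply is_lim_seq_minus'; [exact lq|apply is_lim_seq_const]. }
exact (is_lim_seq_le _ _ _ _ est (is_lim_seq_const _) lim).
Qed.

(** With x = ln(1 - t), a zero of the second factor means x exp x = ln 2 exp(ln 2), hence 1 - t =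
    2. *)
Lemma g_den_neq_0 (t : R) : t < 1 -> t <> 0 -> t <> -1 -> g_den t <> 0.
Proof.
intros h h0 h1; unfold g_den; apply Rmult_integral_contrapositive_currified; [exact h0|].
intros e; apply h1.
assert (e' : ln (1 - t) = ln 2).
{ apply x_exp_x_inj; [exact ln2_pos|]; rewrite !exp_ln by lra; fold ln2; lra. }
apply ln_inv in e'; lra.
Qed.

Lemma is_derive_g_num (t : R) : t < 1 -> is_derive g_num t (2 * ln2 - ln (1 - t) - 1).
Proof. intros h; unfold g_num; auto_derive; [lra|unfold Rminus; field; lra]. Qed.

Lemma is_derive_g_den (t : R) :
  t < 1 -> is_derive g_den t (2 * ln2 - (1 - t) * ln (1 - t) + t * (ln (1 - t) + 1)).
Proof. intros h; unfold g_den; auto_derive; [lra|unfold Rminus; field; lra]. Qed.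

Lemma is_RInt_kern_0 :
  @is_RInt C_R_NormedModule (kern 0) 0 1 (RtoC ((2 * ln2 - 1) / (2 * ln2))).
Proof.
assert (hL := ln2_pos).
assert (hN := is_derive_g_num 0 ltac:(lra)); assert (hD := is_derive_g_den 0 ltac:(lra)).
rewrite !Rminus_0_r, ln_1 in *.
replace (2 * ln2 - 0 - 1) with (2 * ln2 - 1) in hN by ring.
replace (2 * ln2 - 1 * 0 + 0 * (0 + 1)) with (2 * ln2) in hD by ring.
assert (hne : forall n, 0 + step n <> 0 /\ 0 + step n <> -1)
  by (intros n; generalize (step_bounds n); lra).
apply is_RInt_kern_removable; try assumption; try lra.
- unfold g_num; rewrite Rminus_0_r, ln_1; ring.
- unfold g_den; ring.
- intros n; apply g_den_neq_0; try apply hne; generalize (step_bounds n); lra.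
Qed.

Lemma is_RInt_kern_m1 :
  @is_RInt C_R_NormedModule (kern (-1)) 0 1 (RtoC ((1 - ln2) / (1 + ln2))).
Proof.
assert (hL := ln2_pos).
assert (hN := is_derive_g_num (-1) ltac:(lra)); assert (hD := is_derive_g_den (-1) ltac:(lra)).
replace (1 - -1) with 2 in * by ring; fold ln2 in hN, hD.
assert (hne : forall n, -1 + step n <> 0 /\ -1 + step n <> -1)
  by (intros n; generalize (step_bounds n); lra).
replace ((1 - ln2) / (1 + ln2)) with
  ((2 * ln2 - ln2 - 1) / (2 * ln2 - 2 * ln2 + -1 * (ln2 + 1))) by (field; lra).
apply is_RInt_kern_removable; try assumption; try lra.
- unfold g_num; replace (1 - -1) with 2 by ring; fold ln2; ring.
- unfold g_den; replace (1 - -1) with 2 by ring; fold ln2; ring.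
- intros n; apply g_den_neq_0; try apply hne; generalize (step_bounds n); lra.
Qed.

Lemma is_RInt_kern_schur (z : C) :
  off_cut z -> @is_RInt C_R_NormedModule (kern z) 0 1 (schur_g z).
Proof.
intros hz; unfold schur_g; destruct (Ceq_dec z 0) as [->|h0]; [exact is_RInt_kern_0|].
destruct (Ceq_dec z (-1)) as [->|h1]; [exact is_RInt_kern_m1|].
now apply is_RInt_kern_generic.
Qed.

(** * Moments and the power series *)

Lemma continuous_moment (m k : nat) (s : R) :
  0 <= s -> continuous (fun s => s ^ m * (1 - s) ^ k * rho_ext s) s.
Proof.
intros hs; apply (continuous_mult (K := R_AbsRing)); [smooth|].
now apply continuous_rho_ext.
Qed.

Lemma is_RInt_moment (m k : nat) :
  is_RInt (fun s => s ^ m * (1 - s) ^ k * rho_ext s) 0 1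
    (RInt (fun s => s ^ m * (1 - s) ^ k * rho s) 0 1).
Proof.
assert (h : is_RInt (fun s => s ^ m * (1 - s) ^ k * rho_ext s) 0 1
              (RInt (fun s => s ^ m * (1 - s) ^ k * rho_ext s) 0 1)).
{ apply (RInt_correct (V := R_CompleteNormedModule)),
    (ex_RInt_continuous (V := R_CompleteNormedModule)).
  rewrite Rmin_left, Rmax_right by lra; intros s hs; now apply continuous_moment. }
rewrite (RInt_ext _ (fun s => s ^ m * (1 - s) ^ k * rho_ext s)); [exact h|].
rewrite Rmin_left, Rmax_right by lra; intros s hs; now rewrite rho_ext_eq.
Qed.

Lemma ex_RInt_moment (m k : nat) : ex_RInt (fun s => s ^ m * (1 - s) ^ k * rho s) 0 1.
Proof.
exists (RInt (fun s => s ^ m * (1 - s) ^ k * rho s) 0 1).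
apply (is_RInt_ext (V := R_NormedModule)) with (2 := is_RInt_moment m k).
rewrite Rmin_left, Rmax_right by lra; intros s hs; now rewrite rho_ext_eq.
Qed.

Lemma moment_pos (m k : nat) : 0 < RInt (fun s => s ^ m * (1 - s) ^ k * rho s) 0 1.
Proof.
rewrite <- (is_RInt_unique _ _ _ _ (is_RInt_moment m k)).
apply RInt_gt_0; [lra| |intros; now apply continuous_moment].
intros s hs; rewrite rho_ext_eq by exact hs.
apply Rmult_lt_0_compat; [|now apply rho_pos].
apply Rmult_lt_0_compat; apply pow_lt; lra.
Qed.

Lemma moment_b_eq (m : nat) :
  moment_b m = RInt (fun s => s ^ m * (1 - s) ^ 0 * rho s) 0 1.
Proof. apply RInt_ext; intros s _; simpl; now rewrite Rmult_1_r. Qed.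

Lemma is_RInt_moment_b (m : nat) : is_RInt (fun s => s ^ m * rho_ext s) 0 1 (moment_b m).
Proof.
rewrite moment_b_eq.
apply (is_RInt_ext (V := R_NormedModule)) with (2 := is_RInt_moment m 0).
intros s _; simpl; now rewrite Rmult_1_r.
Qed.

Lemma is_RInt_sum_f_R0 (c l : nat -> R) (f : nat -> R -> R) (a b : R) (k : nat) :
  (forall j, is_RInt (f j) a b (l j)) ->
  is_RInt (fun s => sum_f_R0 (fun j => c j * f j s) k) a b (sum_f_R0 (fun j => c j * l j) k).
Proof.
intros h; induction k as [|k IH]; simpl.
- apply (is_RInt_scal (V := R_NormedModule)), h.
- apply (is_RInt_plus (V := R_NormedModule)); [exact IH|].
  apply (is_RInt_scal (V := R_NormedModule)), h.
Qed.

Lemma binomial_moment (k m : nat) :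
  sum_f_R0 (fun j => (-1) ^ j * Binomial.C k j * moment_b (m + j)) k =
  RInt (fun s => s ^ m * (1 - s) ^ k * rho s) 0 1.
Proof.
rewrite <- (is_RInt_unique _ _ _ _ (is_RInt_sum_f_R0 (fun j => (-1) ^ j * Binomial.C k j)
  _ (fun j s => s ^ (m + j) * rho_ext s) 0 1 k (fun j => is_RInt_moment_b (m + j)))).
apply RInt_ext; rewrite Rmin_left, Rmax_right by lra; intros s hs.
rewrite rho_ext_eq by exact hs.
(* This order makes the binomial theorem produce powers (-s)^j, which carry the alternating sign. *)
replace (1 - s) with (- s + 1) by ring; rewrite binomial.
rewrite scal_sum, <- scal_sum, (Rmult_comm _ (rho s)), !scal_sum.
apply sum_eq; intros j _.
rewrite pow1, pow_add; replace (- s) with (-1 * s) by ring; rewrite Rpow_mult_distr; ring.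
Qed.

Lemma is_RInt_RtoC (f : R -> R) (a b l : R) :
  is_RInt f a b l -> @is_RInt C_R_NormedModule (fun s => RtoC (f s)) a b (RtoC l).
Proof.
intros h; apply is_RInt_C; [exact h|].
apply (is_RInt_ext (V := R_NormedModule) (fun _ => 0)); [reflexivity|].
assert (h0 := is_RInt_const (V := R_NormedModule) a b 0).
change (scal (b - a) 0) with ((b - a) * 0) in h0; now rewrite Rmult_0_r in h0.
Qed.

(** A finite geometric sum with its exact remainder, so that only finite sums are ever
    integrated. *)
Lemma geometric_kern (z : C) (s : R) (n : nat) :
  (1 - RtoC s * z)%C <> 0 ->
  sum_n (fun m => RtoC (s ^ m * rho_ext s) * z ^ m : C_NormedModule)%C n =
  (kern z s - kern z s * (RtoC s * z) ^ S n)%C.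
Proof.
intros h; match goal with |- ?a = ?b => change (@eq C a b) end.
induction n as [|n IH].
- rewrite sum_O; unfold kern; simpl; rewrite Rmult_1_l; field; exact h.
- rewrite sum_Sn, IH; change plus with Cplus; unfold kern.
  rewrite RtoC_mult, RtoC_pow, !Cpow_mult_l, !Cpow_S; field; exact h.
Qed.

Lemma is_RInt_sum_n_C (f : nat -> R -> C) (l : nat -> C) (a b : R) (n : nat) :
  (forall m, @is_RInt C_R_NormedModule (f m) a b (l m)) ->
  @is_RInt C_R_NormedModule (fun s => sum_n (fun m => f m s : C_NormedModule) n) a b
    (sum_n (l : nat -> C_NormedModule) n).
Proof.
intros h; induction n as [|n IH].
- rewrite sum_O; apply (is_RInt_ext (V := C_R_NormedModule) (f O)); [|apply h].
  intros s _; now rewrite sum_O.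
- rewrite sum_Sn.
  apply (is_RInt_ext (V := C_R_NormedModule)
    (fun s => sum_n (fun m => f m s : C_NormedModule) n + f (S n) s)%C).
  + intros s _; now rewrite sum_Sn.
  + exact (is_RInt_C_plus _ _ _ _ _ _ IH (h (S n))).
Qed.

(** The remainder in [geometric_kern] is at most M |z|^(n+1)/(1 - |z|) uniformly in s, because |1 -
    s z| >= 1 - |z|; integrating over [0, 1] keeps this bound. *)
Lemma is_series_schur (z : C) :
  Cmod z < 1 ->
  @is_series C_AbsRing C_NormedModule (fun m => RtoC (moment_b m) * z ^ m)%C (schur_g z).
Proof.
intros hz.
assert (hcut : off_cut z).
{ intros (t & ht & ->); rewrite Cmod_R, Rabs_pos_eq in hz by lra; lra. }
destruct rho_ext_bounded as (M & hM0 & hM).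
assert (hr := Cmod_ge_0 z).
assert (hterm : forall m, @is_RInt C_R_NormedModule
  (fun s => RtoC (s ^ m * rho_ext s) * z ^ m)%C 0 1 (RtoC (moment_b m) * z ^ m)%C).
{ intros m; rewrite Cmult_comm.
  apply (is_RInt_C_ext (fun s => z ^ m * RtoC (s ^ m * rho_ext s))%C);
    [lra|intros; apply Cmult_comm|].
  apply is_RInt_Cmult, is_RInt_RtoC, is_RInt_moment_b. }
assert (est : forall n, Cmod (sum_n (fun m => RtoC (moment_b m) * z ^ m : C_NormedModule)%C n
                              - schur_g z) <= M / (1 - Cmod z) * Cmod z ^ S n).
{ intros n.
  assert (h1 := is_RInt_sum_n_C _ _ 0 1 n hterm).
  assert (h2 := is_RInt_C_minus _ _ _ _ _ _ h1 (is_RInt_kern_schur z hcut)).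
  apply (Cmod_RInt_le _ _ _ (M / (1 - Cmod z) * Cmod z ^ S n)) in h2; [lra|lra|].
  intros s hs; assert (hd := kern_den_neq_0 z s hcut hs).
  rewrite geometric_kern by exact hd.
  replace (kern z s - kern z s * (RtoC s * z) ^ S n - kern z s)%C
    with (- (kern z s * (RtoC s * z) ^ S n))%C by ring.
  rewrite Cmod_opp, Cmod_mult, Cmod_pow, Cmod_mult, Cmod_R, Rabs_pos_eq by lra.
  apply Rmult_le_compat; [apply Cmod_ge_0|apply pow_le, Rmult_le_pos; lra| |].
  - apply Cmod_div_le; [lra| |].
    + rewrite Cmod_R, Rabs_pos_eq; apply hM, hs.
    + apply Rle_trans with (2 := Cmod_sub_ge _ _); rewrite Cmod_1, Cmod_mult, Cmod_R.
      rewrite Rabs_pos_eq by lra; nra.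
  - apply pow_incr; nra. }
apply filterlim_locally; intros eps.
assert (hg : is_lim_seq (fun n => M / (1 - Cmod z) * Cmod z ^ S n) 0).
{ replace (Finite 0) with (Rbar_mult (M / (1 - Cmod z)) 0) by (simpl; f_equal; ring).
  apply is_lim_seq_scal_l; apply -> (is_lim_seq_incr_1 (fun n => Cmod z ^ n)).
  apply is_lim_seq_geom; now rewrite Rabs_pos_eq. }
apply is_lim_seq_spec in hg; destruct (hg eps) as [N hN]; exists N; intros n hn.
apply C_NormedModule_mixin_compat1.
apply Rle_lt_trans with (1 := est n).
specialize (hN n hn); rewrite Rminus_0_r in hN.
now apply Rle_lt_trans with (1 := Rle_abs _).
Qed.

Theorem theorem2p9 :
  (forall z : C, ~ (exists t : R, 1 <= t /\ z = RtoC t) ->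
     @is_RInt C_R_NormedModule
       (fun s : R => (RtoC (rho s) / (1 - RtoC s * z))%C) 0 1 (schur_g z)) /\
  (forall z : C, Cmod z < 1 ->
     exists S : C,
       @is_series C_AbsRing C_NormedModule
         (fun m : nat => (RtoC (moment_b m) * z ^ m)%C) S /\
       schur_f z = (- S)%C) /\
  (forall m : nat,
     ex_RInt (fun s : R => s ^ m * rho s) 0 1 /\
     moment_b m = RInt (fun s : R => s ^ m * rho s) 0 1 /\
     0 < moment_b m) /\
  (forall k m : nat,
     ex_RInt (fun s : R => s ^ m * (1 - s) ^ k * rho s) 0 1 /\
     sum_f_R0 (fun j : nat => (-1) ^ j * Binomial.C k j * moment_b (m + j)) k =
       RInt (fun s : R => s ^ m * (1 - s) ^ k * rho s) 0 1 /\
     0 < RInt (fun s : R => s ^ m * (1 - s) ^ k * rho s) 0 1).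
Proof.
split; [|split; [|split]].
- intros z hz.
  apply (is_RInt_C_ext (kern z)); [lra| |now apply is_RInt_kern_schur].
  intros s hs; unfold kern; now rewrite rho_ext_eq.
- intros z hz; exists (schur_g z); split; [now apply is_series_schur|reflexivity].
- intros m; split; [|split; [reflexivity|]].
  + apply (ex_RInt_ext (fun s => s ^ m * (1 - s) ^ 0 * rho s)); [|apply ex_RInt_moment].
    intros s _; simpl; now rewrite Rmult_1_r.
  + rewrite moment_b_eq; apply moment_pos.
- intros k m; split; [apply ex_RInt_moment|split; [apply binomial_moment|apply moment_pos]].
Qed.
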